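(* Let $A$ be any non-trivial amenable group and equip the group $A^{(\mathbf{P}^{1})}$ with the discrete topology. Then $A^{(\mathbf{P}^{1})} \rtimes H(\mathbb{R})_{p}$ is not skew-amenable.
   Context: For a topological group $G$ and $g\in G$ let $\lambda_g\colon G\to G,\ x\mapsto gx$. $\mathrm{LUCB}(G)$ is the algebra of bounded functions $f\colon G\to\mathbb{R}$ that are left-uniformly continuous, i.e., for every $\epsilon>0$ there is a neighborhood $U$ of the neutral element with $|f(x)-f(y)|\le\epsilon$ whenever $x^{-1}y\in U$. A mean on $\mathrm{LUCB}(G)$ is a positive linear functional $\mu$ with $\mu(\mathbf 1)=1$. $G$ is skew-amenable if $\mathrm{LUCB}(G)$ admits a mean $\mu$ with $\mu(f\circ\lambda_g)=\mu(f)$ for all $f\in\mathrm{LUCB}(G)$, $g\in G$. The group $A$ is amenable as a discrete group. Monod's group. Let $\mathbf{P}^1=\mathbf{P}^1(\mathbb{R})$ be the real projective line with its projective topology (the quotient topology inherited from the unit circle $S^1\subseteq\mathbb{R}^2$), let $\infty=[1:0]$, and let $\mathrm{PSL}(2,\mathbb{R})=\mathrm{SL}(2,\mathbb{R})/\{\pm E_2\}$ act naturally by homeomorphisms on $\mathbf{P}^1$. Let $P_{\mathbb{R}}$ be the set of points of $\mathbf{P}^1$ fixed by some hyperbolic element of $\mathrm{PSL}(2,\mathbb{R})$ (trace of absolute value $>2$); in fact $P_{\mathbb{R}}=\mathbf{P}^1$. $H(\mathbb{R})$ is the group of all homeomorphisms of $\mathbf{P}^1$ which fix $\infty$ and are piecewise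 in $\mathrm{PSL}(2,\mathbb{R})$, with finitely many pieces, each piece being an interval in the cyclic order of $\mathbf{P}^1$ with endpoints in $P_{\mathbb{R}}$. $H(\mathbb{R})_p$ denotes $H(\mathbb{R})$ with the topology of pointwise convergence arising from the discrete topology on $\mathbf{P}^1$. $A^{(\mathbf{P}^1)}=\bigoplus_{\mathbf{P}^1}A$ is the group of finitely supported functions $\mathbf{P}^1\to A$. $H(\mathbb{R})$ acts on it by $(g\boldsymbol{.}f)(x)=f(g^{-1}x)$, and $A^{(\mathbf{P}^1)}\rtimes H(\mathbb{R})_p$ is the corresponding semi-direct product, with multiplication $(f,g)(f',g')=(f\cdot(g\boldsymbol{.}f'),gg')$ and the product topology. *)

(* Defs.v *)
From HB Require Import structures.
From mathcomp Require Import all_boot all_order all_algebra.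
From mathcomp Require Import finmap generic_quotient.
From mathcomp Require Import all_classical all_reals.
From mathcomp Require Import topology normedtype.
From mathcomp Require Import ring lra.
Set Implicit Arguments.
Unset Strict Implicit.
Unset Printing Implicit Defensive.
Import Order.TTheory GRing.Theory Num.Theory.
Import numFieldNormedType.Exports.
Local Open Scope classical_set_scope.
Local Open Scope ring_scope.

HB.mixin Record Group_isTopological G of Topological G & Group G := {
  mulg_continuous : continuous (fun xy : G * G => (xy.1 * xy.2)%g);
  invg_continuous : continuous (fun x : G => x^-1%g)
}.

#[short(type="topologicalGroupType")]
HB.structure Definition TopologicalGroup :=
  {G of Topological G & Group G & Group_isTopological G}.

Section mean.
Context {R : realType}.

Definition is_mean (T : Type) (S : {pred (T -> R^o)}) (V : subLmodType S)
    (mu : {scalar V}) : Prop :=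
  (forall f : V, (forall x, 0 <= val f x) -> 0 <= mu f) /\
  (forall f : V, val f = cst 1 -> mu f = 1).

(* [val f'] is f composed with left translation by g; such an f' exists for
   every f and g when V is [linfty R G] or [LUCB R G], see [bfun_translate] and
   [lucb_translate]. *)
Definition left_invariant (G : groupType) (S : {pred (G -> R^o)})
    (V : subLmodType S) (mu : {scalar V}) : Prop :=
  forall (g : G) (f f' : V), val f' = val f \o (fun x => (g * x)%g) ->
  mu f' = mu f.

End mean.

Section bfun.
Variables (R : realType) (T : Type).

Definition bfun : {pred (T -> R^o)} := [pred f : T -> R^o | `[< bounded_fun f >]].

Lemma bfunP (f : T -> R^o) :
  reflect (exists M : R, forall x, `|f x| <= M) (f \in bfun).
Proof.
apply: (iffP idP) => [/asboolP[M [_ fM]]|[M fM]].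
- by exists (M + 1) => x; apply: fM; rewrite ?ltrDl.
- apply/asboolP; exists M; split; first exact: num_real.
  by move=> N MN x _; exact: le_trans (fM x) (ltW MN).
Qed.

Lemma bfun_submod_closed : submod_closed bfun.
Proof.
split=> [|a f g /bfunP[M fM] /bfunP[N gN]]; apply/bfunP.
  by exists 0 => x; rewrite normr0.
exists (`|a| * M + N) => x; apply: (le_trans (ler_normD _ _)).
by rewrite lerD// normrZ ler_wpM2l.
Qed.

HB.instance Definition _ := GRing.isSubmodClosed.Build R (T -> R^o) bfun
  bfun_submod_closed.

Record linfty := Linfty { linfty_val :> T -> R^o; _ : linfty_val \in bfun }.

HB.instance Definition _ := [isSub for linfty_val].
HB.instance Definition _ := [Choice of linfty by <:].
HB.instance Definition _ := [SubChoice_isSubLmodule of linfty by <:].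

End bfun.
Arguments bfun : clear implicits.
Arguments linfty : clear implicits.

Section lucb.
Variables (R : realType) (G : topologicalGroupType).

Definition left_uniformly_continuous (f : G -> R) : Prop :=
  forall eps : R, 0 < eps -> exists2 U : set G, nbhs 1%g U &
    forall x y : G, U (x^-1 * y)%g -> `|f x - f y| <= eps.

Definition lucb : {pred (G -> R^o)} :=
  [pred f : G -> R^o | (f \in bfun R G) && `[< left_uniformly_continuous f >]].

Lemma lucb_submod_closed : submod_closed lucb.
Proof.
have [bf0 bfD] := bfun_submod_closed R G.
split=> [|a f g /andP[bf /asboolP lf] /andP[bg /asboolP lg]].
  apply/andP; split; first exact: bf0.
  apply/asboolP => e e0; exists setT; first exact: filterT.
  by move=> x y _; rewrite subrr normr0 ltW.
apply/andP; split; first exact: bfD.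
apply/asboolP => e e0.
have a1 : 0 < `|a| + 1 by rewrite ltr_wpDl.
have e2 : 0 < e / 2 by rewrite divr_gt0.
have [U U1 fU] := lf (e / 2 / (`|a| + 1)) (divr_gt0 e2 a1).
have [V V1 gV] := lg (e / 2) e2.
exists (U `&` V); first exact: filterI.
move=> x y [Uxy Vxy] /=.
have -> : (a *: f + g) x - (a *: f + g) y = a * (f x - f y) + (g x - g y).
  by rewrite mulrBr opprD addrACA.
apply: (le_trans (ler_normD _ _)); rewrite [e]splitr lerD//; last exact: gV.
rewrite normrM; apply: (@le_trans _ _ ((`|a| + 1) * (e / 2 / (`|a| + 1)))).
  by rewrite ler_pM// ?lerDl//; exact: fU.
by rewrite mulrC divfK// gt_eqF.
Qed.

HB.instance Definition _ := GRing.isSubmodClosed.Build R (G -> R^o) lucb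
  lucb_submod_closed.

Record LUCB := MkLUCB { LUCB_val :> G -> R^o; _ : LUCB_val \in lucb }.

HB.instance Definition _ := [isSub for LUCB_val].
HB.instance Definition _ := [Choice of LUCB by <:].
HB.instance Definition _ := [SubChoice_isSubLmodule of LUCB by <:].

End lucb.
Arguments lucb : clear implicits.
Arguments LUCB : clear implicits.

Lemma bfun_cst (R : realType) (T : Type) (a : R) : cst a \in bfun R T.
Proof. by apply/bfunP; exists `|a|. Qed.

Lemma bfun_translate (R : realType) (G : groupType) (f : linfty R G) (g : G) :
  val f \o (fun x => (g * x)%g) \in bfun R G.
Proof. by have /bfunP[M fM] := valP f; apply/bfunP; exists M => x; exact: fM. Qed.

Lemma lucb_cst (R : realType) (G : topologicalGroupType) (a : R) :
  cst a \in lucb R G.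
Proof.
apply/andP; split; first exact: bfun_cst.
apply/asboolP => e e0; exists setT; first exact: filterT.
by move=> x y _; rewrite subrr normr0 ltW.
Qed.

Lemma lucb_translate (R : realType) (G : topologicalGroupType) (f : LUCB R G)
  (g : G) : val f \o (fun x => (g * x)%g) \in lucb R G.
Proof.
have /andP[bf /asboolP lf] := valP f; apply/andP; split.
  exact: (bfun_translate (Linfty bf)).
apply/asboolP => e /lf[U U1 fU]; exists U => // x y Uxy /=; apply: fU.
by rewrite invgM -mulgA mulKg.
Qed.

(* amenability of A as a discrete group *)
Definition amenable (R : realType) (A : groupType) : Prop :=
  exists mu : {scalar linfty R A}, is_mean mu /\ left_invariant mu.

Definition skew_amenable (R : realType) (G : topologicalGroupType) : Prop :=
  exists mu : {scalar LUCB R G}, is_mean mu /\ left_invariant mu.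

Section circle.
Local Open Scope quotient_scope.
Variable R : realType.

Definition circle : set 'cV[R]_2 :=
  [set v | v 0 0 ^+ 2 + v 1 0 ^+ 2 = 1].

Definition antipodal (u v : set_type circle) : bool :=
  (val u == val v) || (val u == - val v).

Lemma antipodal_refl : reflexive antipodal.
Proof. by move=> u; rewrite /antipodal eqxx. Qed.

Lemma antipodal_sym : symmetric antipodal.
Proof. by move=> u v; rewrite /antipodal ![val v == _]eq_sym eqr_oppLR. Qed.

Lemma antipodal_trans : transitive antipodal.
Proof.
move=> v u w /orP[|] /eqP uv /orP[|] /eqP vw; apply/orP;
  rewrite uv vw ?opprK ?eqxx; by [left|right].
Qed.

Canonical antipodal_equiv :=
  EquivRel antipodal antipodal_refl antipodal_sym antipodal_trans.

Definition P1 : Type := quotient_topology {eq_quot antipodal}.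

HB.instance Definition _ := Topological.on P1.
HB.instance Definition _ := Choice.on P1.
HB.instance Definition _ := Quotient.on P1.


Lemma normalize_circle (v : 'cV[R]_2) : v != 0 ->
  (Num.sqrt (v 0 0 ^+ 2 + v 1 0 ^+ 2))^-1 *: v \in circle.
Proof.
move=> v0; rewrite inE /circle /= !mxE !exprMn -mulrDr exprVn sqr_sqrtr; last first.
  by rewrite addr_ge0 ?sqr_ge0.
rewrite mulVf//; apply: contra_neq v0 => /eqP.
rewrite paddr_eq0 ?sqr_ge0// !sqrf_eq0 => /andP[/eqP v0 /eqP v1].
apply/colP => i; rewrite mxE; have [->|->] : i = 0 \/ i = 1; rewrite //.
by case: i => -[|[|//]] hi; [left|right]; exact: val_inj.
Qed.

Lemma circle_pole : (delta_mx 0 0 : 'cV[R]_2) \in circle.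
Proof. by rewrite inE /circle /= !mxE /= expr1n expr0n addr0. Qed.

(* [hpoint v] is the point [v_0 : v_1] of the projective line; it is junk for
   v = 0. *)
Definition hpoint (v : 'cV[R]_2) : P1 :=
  \pi_P1 (insubd (exist _ (delta_mx 0 0) circle_pole : set_type circle)
           ((Num.sqrt (v 0 0 ^+ 2 + v 1 0 ^+ 2))^-1 *: v)).

Definition hcoord (x : P1) : 'cV[R]_2 := val (repr x).

Definition P1_infty : P1 := hpoint (delta_mx 0 0).

Lemma hcoord_circle (x : P1) : hcoord x 0 0 ^+ 2 + hcoord x 1 0 ^+ 2 = 1.
Proof. by exact: set_mem (valP (repr x)). Qed.

Lemma hcoord_neq0 (x : P1) : hcoord x != 0.
Proof.
apply/eqP => x0; have := hcoord_circle x.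
by rewrite x0 !mxE expr0n addr0 => /eqP; rewrite eq_sym oner_eq0.
Qed.

Lemma hcoordK : cancel hcoord hpoint.
Proof.
move=> x; rewrite /hpoint hcoord_circle sqrtr1 invr1 scale1r.
by rewrite /hcoord valKd reprK.
Qed.

Lemma hpointE (v : 'cV[R]_2) : v != 0 ->
  exists2 a, a != 0 & hcoord (hpoint v) = a *: v.
Proof.
move=> v0; have vc := normalize_circle v0.
rewrite /hcoord /hpoint; set n := (Num.sqrt _)^-1 in vc *.
have n0 : n != 0.
  apply/eqP => n0; move: vc; rewrite n0 scale0r inE /circle /= !mxE expr0n addr0.
  by move/eqP; rewrite eq_sym oner_eq0.
set y := insubd _ _.
have /orP[] : antipodal (repr (\pi_P1 y)) y.
- by rewrite -[antipodal _ _](@eqmodE _ antipodal_equiv) reprK.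
- by move=> /eqP ->; exists n => //; rewrite insubdK.
- move=> /eqP ->; exists (- n); first by rewrite oppr_eq0.
  by rewrite insubdK// scaleNr.
Qed.

Lemma hpoint_scale (a : R) (v : 'cV[R]_2) : a != 0 -> hpoint (a *: v) = hpoint v.
Proof.
move=> a0; have [->|v0] := eqVneq v 0; first by rewrite scaler0.
have av0 : a *: v != 0 by rewrite scaler_eq0 negb_or a0.
have /= vc := normalize_circle v0; have /= avc := normalize_circle av0.
apply/eqmodP; rewrite /= /antipodal !insubdK//.
rewrite !mxE !exprMn -mulrDr sqrtrM ?sqr_ge0// sqrtr_sqr invfM scalerA.
rewrite mulrAC; have [a1|a1] := ltP 0 a.
- by rewrite gtr0_norm// mulVf// mul1r eqxx.
- by rewrite ler0_norm// invrN mulNr mulVf// mulN1r scaleNr eqxx orbT.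
Qed.

End circle.

Lemma mem_seq4 (T : eqType) (a b c d : T) (s := [:: a; b; c; d]) :
  [/\ a \in s, b \in s, c \in s & d \in s].
Proof. by split; rewrite !inE eqxx ?orbT. Qed.

Section mobius.
Variable R : realType.
Local Notation P1 := (P1 R).
Implicit Types (x y z a b c d p q : P1) (A B : 'M[R]_2) (u v : 'cV[R]_2).

Definition mobius (A : 'M[R]_2) (x : P1) : P1 := hpoint (A *m hcoord x).

Lemma hcoord_mobius A x : A \in unitmx ->
  exists2 k, k != 0 & hcoord (mobius A x) = k *: (A *m hcoord x).
Proof.
move=> Au; apply: hpointE; apply: contra_neq (hcoord_neq0 x) => Ax0.
by rewrite -[hcoord x](mulKmx Au) Ax0 mulmx0.
Qed.

Lemma mobiusM A B x : B \in unitmx -> mobius (A *m B) x = mobius A (mobius B x).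
Proof.
move=> Bu; have [k k0 Bx] := hcoord_mobius x Bu.
by rewrite {2}/mobius Bx -scalemxAr hpoint_scale// mulmxA.
Qed.

Lemma mobius1 x : mobius 1%:M x = x.
Proof. by rewrite /mobius mul1mx hcoordK. Qed.

Lemma mobiusK A : A \in unitmx -> cancel (mobius A) (mobius (invmx A)).
Proof. by move=> Au x; rewrite -mobiusM// mulVmx// mobius1. Qed.

Lemma mobiusKV A : A \in unitmx -> cancel (mobius (invmx A)) (mobius A).
Proof. by move=> Au x; rewrite -mobiusM ?unitmx_inv// mulmxV// mobius1. Qed.

Lemma det1_unitmx A : \det A = 1 -> A \in unitmx.
Proof. by move=> A1; rewrite unitmxE A1 unitr1. Qed.

(* The elements of PSL(2,R) are represented by matrices of determinant 1, the
   sign ambiguity being immaterial both for [mobius A] and for [`|\tr A|]. *)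
Definition hyperbolic (A : 'M[R]_2) : Prop := \det A = 1 /\ 2 < `|\tr A|.

Definition P_R : set P1 :=
  [set x | exists2 A : 'M[R]_2, hyperbolic A & mobius A x = x].

Definition wedge (u v : 'cV[R]_2) : R := u 0 0 * v 1 0 - u 1 0 * v 0 0.

(* [cyc x y z]: the points x, y, z are distinct and occur in this order when
   the circle is run through in a fixed direction; the sign of the product
   does not depend on the choice of homogeneous coordinates. *)
Definition cyc (x y z : P1) : bool :=
  0 < wedge (hcoord x) (hcoord y) * wedge (hcoord y) (hcoord z) *
      wedge (hcoord z) (hcoord x).

(* the closed interval from a to b in the cyclic order; [arc a a] is {a} *)
Definition arc (a b : P1) : set P1 := [set x | [\/ x = a, x = b | cyc a x b]].

Lemma wedgeC u v : wedge u v = - wedge v u.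
Proof. by rewrite /wedge; ring. Qed.

Lemma wedgeZl (k : R) u v : wedge (k *: u) v = k * wedge u v.
Proof. by rewrite /wedge !mxE; ring. Qed.

Lemma wedgeZr (k : R) u v : wedge u (k *: v) = k * wedge u v.
Proof. by rewrite /wedge !mxE; ring. Qed.

Lemma det22 A : \det A = A 0 0 * A 1 1 - A 0 1 * A 1 0.
Proof.
rewrite (expand_det_row _ ord0) !big_ord_recl big_ord0 addr0 /cofactor.
rewrite !det_mx11 !mxE /= expr0 expr1 mul1r mulN1r mulrN.
by congr (A _ _ * A _ _ - A _ _ * A _ _); exact: val_inj.
Qed.

Lemma mulmx2 A v i : (A *m v) i 0 = A i 0 * v 0 0 + A i 1 * v 1 0.
Proof.
rewrite mxE !big_ord_recl big_ord0 addr0.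
by congr (A _ _ * v _ _ + A _ _ * v _ _); exact: val_inj.
Qed.

Lemma wedge_mulmx A u v : wedge (A *m u) (A *m v) = \det A * wedge u v.
Proof. by rewrite /wedge !mulmx2 det22; ring. Qed.

Lemma wedge_hcoord_eq0 x y : wedge (hcoord x) (hcoord y) = 0 -> x = y.
Proof.
move=> w0; rewrite -(hcoordK x) -(hcoordK y).
set u := hcoord x in w0 *; set v := hcoord y in w0 *.
pose k := u 0 0 * v 0 0 + u 1 0 * v 1 0.
have hu : u 0 0 ^+ 2 + u 1 0 ^+ 2 = 1 := hcoord_circle x.
have vE : v = k *: u.
  apply/colP => i; rewrite mxE.
  have [->|->] : i = 0 \/ i = 1.
    by case: i => -[|[|//]] hi; [left|right]; exact: val_inj.
  - rewrite -[LHS]mul1r -hu; apply/eqP; rewrite -subr_eq0; apply/eqP.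
    transitivity (- u 1 0 * wedge u v); first by rewrite /k /wedge; ring.
    by rewrite w0 mulr0.
  - rewrite -[LHS]mul1r -hu; apply/eqP; rewrite -subr_eq0; apply/eqP.
    transitivity (u 0 0 * wedge u v); first by rewrite /k /wedge; ring.
    by rewrite w0 mulr0.
rewrite vE hpoint_scale//; apply: contra_neq (hcoord_neq0 y) => k0.
by rewrite -/v vE k0 scale0r.
Qed.

Lemma cyc_rot x y z : cyc x y z = cyc y z x.
Proof. by rewrite /cyc; congr (0 < _); ring. Qed.

Lemma cyc_asym x y z : cyc x y z -> cyc x z y -> False.
Proof.
rewrite /cyc (wedgeC (hcoord x) (hcoord z)) (wedgeC (hcoord z) (hcoord y)).
by rewrite (wedgeC (hcoord y) (hcoord x)) => h1 h2; nra.
Qed.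

Lemma cyc_total x y z : x <> y -> y <> z -> z <> x -> cyc x y z \/ cyc x z y.
Proof.
move=> xy yz zx; rewrite /cyc (wedgeC (hcoord x) (hcoord z)).
rewrite (wedgeC (hcoord z) (hcoord y)) (wedgeC (hcoord y) (hcoord x)).
set r := wedge _ _; set s := wedge (hcoord y) _; set t := wedge (hcoord z) _.
have : r * s * t != 0.
  by rewrite !mulf_neq0//; apply/eqP => /wedge_hcoord_eq0.
rewrite neq_lt => /orP[h|h]; [right|left=> //].
by rewrite (_ : _ * _ = - (r * s * t)) ?oppr_gt0//; ring.
Qed.

Lemma cyc_trans x a b c : cyc x a b -> cyc x b c -> cyc x a c.
Proof.
rewrite /cyc; set u := hcoord x; set v := hcoord a; set w := hcoord b.
set z := hcoord c => h1 h2.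
have uw0 : wedge u w != 0.
  by apply: contraTneq h2 => ->; rewrite !mul0r ltxx.
have uv0 : wedge u v != 0.
  by apply: contraTneq h1 => ->; rewrite !mul0r ltxx.
have uw2 : 0 < wedge u w ^+ 2 by rewrite exprn_even_gt0.
have uv2 : 0 < wedge u v ^+ 2 by rewrite exprn_even_gt0.
rewrite -(pmulr_rgt0 _ uw2).
have -> : wedge u w ^+ 2 * (wedge u v * wedge v z * wedge z u) =
  wedge u v ^+ 2 * (wedge u w * wedge w z * wedge z u) +
  wedge z u ^+ 2 * (wedge u v * wedge v w * wedge w u) by rewrite /wedge; ring.
by apply: ltr_wpDr; [rewrite mulr_ge0 ?sqr_ge0// ltW|exact: mulr_gt0].
Qed.

Lemma cyc_rotl x y z : cyc x y z -> cyc y z x.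
Proof. by rewrite cyc_rot. Qed.

Lemma cyc_rotr x y z : cyc x y z -> cyc z x y.
Proof. by rewrite -cyc_rot. Qed.

Lemma cyc_neq x a : cyc x x a -> False.
Proof. by move=> h; exact: cyc_asym h (cyc_rotl h). Qed.

Lemma cyc_lin x a b c : cyc x a b -> cyc x b c -> cyc a b c.
Proof.
move=> xab xbc; apply: cyc_rotr; apply: cyc_trans (cyc_rotl xbc) _.
exact: cyc_rotr.
Qed.

Lemma arcE a b x y : cyc a x b ->
  arc a b y <-> [\/ y = x, (y = a \/ cyc x a y) | (y = b \/ cyc x y b)].
Proof.
move=> axb; have xba : cyc x b a := cyc_rotl axb.
split=> [[->|->|ayb]|[->|[->|h]|[->|h]]].
- by apply: Or32; left.
- by apply: Or33; left.
- have [->|/eqP yx] := eqVneq y x; first exact: Or31.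
  have [->|/eqP ya] := eqVneq y a; first by apply: Or32; left.
  have [->|/eqP yb] := eqVneq y b; first by apply: Or33; left.
  have ax : a <> x by move=> ax; apply: (@cyc_neq x b); rewrite {1}ax in axb.
  have xb : b <> x by move=> bx; apply: (@cyc_neq x a); rewrite bx in xba.
  have [h|h] := cyc_total (nesym ax) (nesym ya) yx; first by apply: Or32; right.
  have [h'|h'] := cyc_total (nesym yx) yb xb; first by apply: Or33; right.
  by exfalso; exact: (cyc_asym (cyc_lin h' h) (cyc_rotr ayb)).
- exact: Or33.
- exact: Or31.
- by apply: Or33; apply: cyc_rotl; exact: cyc_lin h.
- exact: Or32.
- by apply: Or33; apply: cyc_rotr; exact: cyc_lin xba.
Qed.

Lemma arcxx a x : arc a a x -> x = a.
Proof. by case=> // /cyc_rotr /cyc_neq. Qed.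

Lemma arcI a b c d x : arc a b x -> arc c d x ->
  exists p q, [/\ arc p q x, arc p q `<=` arc a b, arc p q `<=` arc c d,
    p \in [:: a; b; c; d] & q \in [:: a; b; c; d]].
Proof.
move=> abx cdx; have [xE|] := boolP (x \in [:: a; b; c; d]).
  by exists x, x; split=> //; [exact: Or31| |] => y /arcxx ->.
rewrite !inE !negb_or => /and4P[/eqP xa /eqP xb /eqP xc /eqP xd].
have axb : cyc a x b by case: abx.
have cxd : cyc c x d by case: cdx.
have xba : cyc x b a := cyc_rotl axb.
have xdc : cyc x d c := cyc_rotl cxd.
have [p [pE ap cp]] : exists p, [/\ p = a \/ p = c,
    p = a \/ cyc x a p & p = c \/ cyc x c p].
  have [->|/eqP ac] := eqVneq a c; first by exists c; split; left.
  have [h|h] := cyc_total xa ac (nesym xc).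
  - by exists c; split; [right|right|left].
  - by exists a; split; [left|left|right].
have [q [qE qb qd]] : exists q, [/\ q = b \/ q = d,
    q = b \/ cyc x q b & q = d \/ cyc x q d].
  have [->|/eqP bd] := eqVneq b d; first by exists d; split; left.
  have [h|h] := cyc_total xb bd (nesym xd).
  - by exists b; split; [left|left|right].
  - by exists d; split; [right|right|left].
have pxq : cyc p x q.
  apply: cyc_rotr; have xqa : cyc x q a.
    by case: qb => [->//|h]; exact: cyc_trans h xba.
  by case: ap => [->//|h]; exact: cyc_trans xqa h.
exists p, q; split.
- exact: Or33.
- move=> y /(arcE _ pxq)[->|py|qy]; apply/(arcE _ axb); first exact: Or31.
  + apply: Or32; case: py => [->//|py]; case: ap => [<-|ap]; first by right.
    by right; exact: cyc_trans ap py.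
  + apply: Or33; case: qy => [->//|qy]; case: qb => [<-|qb]; first by right.
    by right; exact: cyc_trans qy qb.
- move=> y /(arcE _ pxq)[->|py|qy]; apply/(arcE _ cxd); first exact: Or31.
  + apply: Or32; case: py => [->//|py]; case: cp => [<-|cp]; first by right.
    by right; exact: cyc_trans cp py.
  + apply: Or33; case: qy => [->//|qy]; case: qd => [<-|qd]; first by right.
    by right; exact: cyc_trans qy qd.
- by have [? _ ? _] := mem_seq4 a b c d; case: pE => ->.
- by have [_ ? _ ?] := mem_seq4 a b c d; case: qE => ->.
Qed.

Lemma cyc_mobius A x y z : \det A = 1 ->
  cyc (mobius A x) (mobius A y) (mobius A z) = cyc x y z.
Proof.
move=> A1; have Au := det1_unitmx A1; rewrite /cyc.
have [i i0 ->] := hcoord_mobius x Au.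
have [j j0 ->] := hcoord_mobius y Au.
have [k k0 ->] := hcoord_mobius z Au.
rewrite !wedgeZl !wedgeZr !wedge_mulmx A1 !mul1r.
set r := wedge _ _; set s := wedge (hcoord y) _; set t := wedge (hcoord z) _.
have -> : i * (j * r) * (j * (k * s)) * (k * (i * t)) =
  (i * j * k) ^+ 2 * (r * s * t) by ring.
by rewrite pmulr_rgt0// exprn_even_gt0//= !mulf_neq0.
Qed.

Lemma arc_mobius A a b x : \det A = 1 ->
  arc (mobius A a) (mobius A b) (mobius A x) <-> arc a b x.
Proof.
move=> A1; have Ai := can_inj (mobiusK (det1_unitmx A1)).
rewrite /arc /= cyc_mobius//; split=> -[h|h|h].
- by apply: Or31; exact: Ai.
- by apply: Or32; exact: Ai.
- exact: Or33.
- by apply: Or31; rewrite h.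
- by apply: Or32; rewrite h.
- exact: Or33.
Qed.

Lemma P_RT : P_R = setT.
Proof.
rewrite -subTset => x _; set u := hcoord x.
have u1 : u 0 0 ^+ 2 + u 1 0 ^+ 2 = 1 := hcoord_circle x.
pose A : 'M[R]_2 := \matrix_(i, j) (2 * (u i 0 * u j 0) +
  (if i == j then 2^-1 - 2^-1 * (u i 0 * u j 0) else - (2^-1 * (u i 0 * u j 0)))).
have Au : A *m u = 2 *: u.
  apply/colP => i; rewrite mulmx2 !mxE.
  have [->|->] : i = 0 \/ i = 1.
    by case: i => -[|[|//]] hi; [left|right]; exact: val_inj.
  - rewrite /=; transitivity (2 * u 0 0 * (u 0 0 ^+ 2 + u 1 0 ^+ 2) +
      2^-1 * u 0 0 * (1 - (u 0 0 ^+ 2 + u 1 0 ^+ 2))); first by field.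
    by rewrite u1; field.
  - rewrite /=; transitivity (2 * u 1 0 * (u 0 0 ^+ 2 + u 1 0 ^+ 2) +
      2^-1 * u 1 0 * (1 - (u 0 0 ^+ 2 + u 1 0 ^+ 2))); first by field.
    by rewrite u1; field.
have detA : \det A = 1.
  rewrite det22 !mxE /=.
  transitivity (4^-1 + (1 - 4^-1) * (u 0 0 ^+ 2 + u 1 0 ^+ 2)); first by field.
  by rewrite u1; field.
have n2 : (2 : R) != 0 by rewrite pnatr_eq0.
exists A; last by rewrite /mobius -/u Au (hpoint_scale _ n2) hcoordK.
split=> //; rewrite /mxtrace !big_ord_recl big_ord0 !mxE /= addr0.
rewrite (_ : lift ord0 ord0 = 1 :> 'I_2); last exact: val_inj.
rewrite (_ : _ + _ = 1 + 3 / 2 * (u 0 0 ^+ 2 + u 1 0 ^+ 2)); last by field.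
by rewrite u1 mulr1 gtr0_norm; lra.
Qed.

End mobius.

Definition homeomorphism (T U : topologicalType) (f : T -> U) : Prop :=
  exists g : U -> T, [/\ cancel f g, cancel g f, continuous f & continuous g].

Section monod.
Variable R : realType.
Local Notation P1 := (P1 R).
Implicit Types (h : P1 -> P1) (a b x : P1).

Definition PSL2_on (h : P1 -> P1) (I : set P1) : Prop :=
  exists2 A : 'M[R]_2, \det A = 1 & {in I, h =1 mobius A}.

(* The pieces are closed arcs; as h is continuous, this is no restriction. *)
Definition piecewise_PSL2 (h : P1 -> P1) : Prop :=
  exists s : seq (P1 * P1),
    [/\ forall ab, ab \in s -> @P_R R ab.1 /\ @P_R R ab.2,
        forall ab, ab \in s -> PSL2_on h (arc ab.1 ab.2)
      & forall x, exists2 ab, ab \in s & arc ab.1 ab.2 x].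

Definition monod : set (P1 -> P1) :=
  [set h | [/\ homeomorphism h, h (P1_infty R) = P1_infty R
             & piecewise_PSL2 h]].

Lemma piecewise_id : piecewise_PSL2 id.
Proof.
have PR x : P_R x by rewrite P_RT.
pose a := P1_infty R; pose b : P1 := hpoint (delta_mx 1 0).
have ab : a <> b.
  move=> ab; have [k k0 ak] : exists2 k : R, k != 0 & hcoord a = k *: delta_mx 0 0.
    by apply: hpointE; apply/eqP => /matrixP/(_ 0 0)/eqP; rewrite !mxE/= oner_eq0.
  have [l l0 bl] : exists2 k : R, k != 0 & hcoord b = k *: delta_mx 1 0.
    by apply: hpointE; apply/eqP => /matrixP/(_ 1 0)/eqP; rewrite !mxE/= oner_eq0.
  have := congr1 (fun u : 'cV[R]_2 => u 0 0) ak.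
  by rewrite ab bl !mxE /= mulr0 mulr1 => /esym/eqP; rewrite (negPf k0).
exists [:: (a, b); (b, a)]; split=> [//|c _|x].
  by exists 1%:M; [rewrite det1|move=> x _; rewrite mobius1].
have [->|/eqP xa] := eqVneq x a.
  by exists (a, b); [rewrite mem_head|exact: Or31].
have [->|/eqP xb] := eqVneq x b.
  by exists (a, b); [rewrite mem_head|exact: Or32].
have [h|h] := cyc_total (nesym xa) xb (nesym ab).
  by exists (a, b); [rewrite mem_head|exact: Or33].
exists (b, a); last by apply: Or33; exact: cyc_rotl.
by rewrite mem_behead//= mem_head.
Qed.

Lemma piecewise_comp g h (g' h' : P1 -> P1) : cancel h h' -> cancel h' h ->
  piecewise_PSL2 g -> piecewise_PSL2 h -> piecewise_PSL2 (g \o h).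
Proof.
move=> hK h'K [s [_ gA gs]] [t [_ hA ht]].
pose E := flatten [seq [:: c.1; c.2] | c <- t] ++
  [seq h' x | x <- flatten [seq [:: c.1; c.2] | c <- s]].
exists [seq pq <- [seq (p, q) | p <- E, q <- E] |
  `[< PSL2_on (g \o h) (arc pq.1 pq.2) >]]; split.
- by move=> pq _; rewrite !P_RT.
- by move=> pq; rewrite mem_filter => /andP[/asboolP].
move=> x; have [[a b] tab xab] := ht x; have [[c d] scd hxcd] := gs (h x).
have [A A1 /= hE] := hA _ tab; have [B B1 /= gE] := gA _ scd.
have Au := det1_unitmx A1.
have hxE : h x = mobius A x by apply: hE; exact/mem_set.
pose c' := mobius (invmx A) c; pose d' := mobius (invmx A) d.
have cE : c = mobius A c' by rewrite mobiusKV.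
have dE : d = mobius A d' by rewrite mobiusKV.
have xcd' : arc c' d' x.
  by apply: (iffLR (arc_mobius c' d' x A1)); rewrite -cE -dE -hxE.
have [p [q [pqx pqab pqcd pE qE]]] := arcI xab xcd'.
have inE y : arc a b y -> y \in [:: a; b; c'; d'] -> y \in E.
  move=> aby; rewrite mem_cat.
  have [abE cdE] : {subset [:: a; b] <= flatten [seq [:: c.1; c.2] | c <- t]} /\
    {subset [:: c; d] <= flatten [seq [:: c.1; c.2] | c <- s]}.
    split=> z zE; apply/flattenP; [exists [:: a; b]|exists [:: c; d]] => //;
      apply/mapP; [by exists (a, b)|by exists (c, d)].
  have hyE : h y = mobius A y by apply: hE; exact/mem_set.
  rewrite -[[:: a; b; c'; d']]/([:: a; b] ++ [:: c'; d']) mem_cat => /orP[/abE->//|].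
  move=> ycd; apply/orP; right; apply/mapP; exists (h y); last by rewrite hK.
  apply: cdE; rewrite hyE cE dE.
  exact: (map_f (mobius A) ycd).
have PQ : PSL2_on (g \o h) (arc p q).
  exists (B *m A); first by rewrite det_mulmx A1 B1 mulr1.
  move=> y /set_mem pqy /=; have aby := pqab _ pqy.
  have hyE : h y = mobius A y by apply: hE; exact/mem_set.
  rewrite mobiusM// -hyE; apply: gE; apply/mem_set.
  by rewrite hyE cE dE; apply: (iffRL (arc_mobius c' d' y A1)); exact: pqcd.
exists (p, q) => //; rewrite mem_filter; apply/andP; split; first exact/asboolP.
apply: allpairs_f; apply: inE => //; apply: pqab; [exact: Or31|exact: Or32].
Qed.

Lemma piecewise_inv h h' : cancel h h' -> cancel h' h ->
  piecewise_PSL2 h -> piecewise_PSL2 h'.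
Proof.
move=> hK h'K [s [_ hA hs]].
exists [seq (h c.1, h c.2) | c <- s]; split.
- by move=> ab _; rewrite !P_RT.
- move=> _ /mapP[[a b] sab ->] /=; have [A A1 /= hE] := hA _ sab.
  have Au := det1_unitmx A1.
  exists (invmx A); first by rewrite det_inv A1 invr1.
  have -> : h a = mobius A a by apply: hE; apply/mem_set; exact: Or31.
  have -> : h b = mobius A b by apply: hE; apply/mem_set; exact: Or32.
  move=> x /set_mem; rewrite -{1}(mobiusKV Au x).
  move=> /(iffLR (arc_mobius a b (mobius (invmx A) x) A1)) abx.
  apply: (can_inj hK); rewrite h'K hE ?mobiusKV//; exact/mem_set.
- move=> x; have [[a b] sab h'xab] := hs (h' x); exists (h a, h b).
    by apply/mapP; exists (a, b).
  have [A A1 /= hE] := hA _ sab.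
  have -> : h a = mobius A a by apply: hE; apply/mem_set; exact: Or31.
  have -> : h b = mobius A b by apply: hE; apply/mem_set; exact: Or32.
  rewrite -(h'K x) (hE (h' x)); last exact/mem_set.
  exact: (iffRL (arc_mobius a b (h' x) A1)).
Qed.

Lemma homeomorphism_id (T : topologicalType) : homeomorphism (@id T).
Proof. by exists id; split=> // x; exact: cvg_id. Qed.

Lemma homeomorphism_comp (T U V : topologicalType) (g : U -> V) (h : T -> U) :
  homeomorphism g -> homeomorphism h -> homeomorphism (g \o h).
Proof.
move=> [g' [gK g'K gc g'c]] [h' [hK h'K hc h'c]].
exists (h' \o g'); split; [exact: can_comp|exact: can_comp| |] => x.
- by apply: continuous_comp; [exact: hc|exact: gc].
- by apply: continuous_comp; [exact: g'c|exact: h'c].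
Qed.

Lemma monod1 : monod id.
Proof. by split=> //; [exact: homeomorphism_id|exact: piecewise_id]. Qed.

Lemma monodM g h : monod g -> monod h -> monod (g \o h).
Proof.
move=> [gh gi gp] [hh hi hp]; split; first exact: homeomorphism_comp.
- by rewrite /= hi gi.
- by have [h' [hK h'K _ _]] := hh; exact: (piecewise_comp id hK h'K gp hp).
Qed.

Lemma monodV h : monod h ->
  exists h', [/\ monod h', cancel h h' & cancel h' h].
Proof.
move=> [[h' [hK h'K hc h'c]] hi hp]; exists h'; split=> //; split.
- by exists h; split.
- by rewrite -{1}hi hK.
- exact: piecewise_inv hK h'K hp.
Qed.

End monod.

Section HR.
Variable R : realType.
Local Notation P1 := (P1 R).

Definition HR : Type := set_type (@monod R).

HB.instance Definition _ := SubChoice.on HR.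

Definition HR_fun (h : HR) : P1 -> P1 := set_val h.
Coercion HR_fun : HR >-> Funclass.

Lemma HR_eqP (g h : HR) : g =1 h -> g = h.
Proof. by move=> gh; apply: val_inj; exact: funext. Qed.

Definition HR_one : HR := exist _ id (mem_set (monod1 R)).

Definition HR_mul (g h : HR) : HR :=
  exist _ (g \o h) (mem_set (monodM (set_mem (valP g)) (set_mem (valP h)))).

Lemma HR_inv_subproof (h : HR) : exists h' : HR, cancel h h' /\ cancel h' h.
Proof.
have [h' [mh' hK h'K]] := monodV (set_mem (valP h)).
by exists (exist _ h' (mem_set mh')).
Qed.

Definition HR_inv (h : HR) : HR := sval (cid (HR_inv_subproof h)).

Lemma HR_invK (h : HR) : cancel h (HR_inv h).
Proof. by rewrite /HR_inv; case: cid => h' []. Qed.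

Lemma HR_invKV (h : HR) : cancel (HR_inv h) h.
Proof. by rewrite /HR_inv; case: cid => h' []. Qed.

Lemma HR_mulA : associative HR_mul.
Proof. by move=> g h k; exact: HR_eqP. Qed.

Lemma HR_mul1 : left_id HR_one HR_mul.
Proof. by move=> g; exact: HR_eqP. Qed.

Lemma HR_mulr1 : right_id HR_one HR_mul.
Proof. by move=> g; exact: HR_eqP. Qed.

Lemma HR_mulV : left_inverse HR_one HR_inv HR_mul.
Proof. by move=> g; apply: HR_eqP => x; exact: HR_invK. Qed.

Lemma HR_mulrV : right_inverse HR_one HR_inv HR_mul.
Proof. by move=> g; apply: HR_eqP => x; exact: HR_invKV. Qed.

HB.instance Definition _ := isGroup.Build HR
  HR_mulA HR_mul1 HR_mulr1 HR_mulV HR_mulrV.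

HB.instance Definition _ := Topological.copy HR
  (initial_topology (HR_fun : HR -> {ptws P1 -> discrete_topology P1})).

Lemma HR_mulE (g h : HR) x : ((g * h)%g : HR) x = g (h x). Proof. by []. Qed.

Lemma HR_oneE x : (1%g : HR) x = x. Proof. by []. Qed.

Lemma HR_Vk (h : HR) : cancel h (h^-1%g : HR). Proof. exact: HR_invK. Qed.

Lemma HR_VkV (h : HR) : cancel (h^-1%g : HR) h. Proof. exact: HR_invKV. Qed.

Lemma HR_nbhsP (g : HR) (U : set HR) : nbhs g U <->
  exists F : seq P1, forall h : HR, {in F, h =1 g} -> U h.
Proof.
split=> [|[F FU]].
  pose G : set_system HR := filter_from [set: seq P1]
    (fun F => [set h : HR | {in F, h =1 g}]).
  have GF : Filter G.
    apply: filter_from_filter; first by exists [::].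
    move=> E F _ _; exists (E ++ F) => // h hEF; split=> x xE; apply: hEF;
      by rewrite mem_cat xE ?orbT.
  suff Gg : G --> g by move=> /Gg[F _ FU]; exists F => h hF; exact: FU.
  have Gf : (HR_fun : HR -> {ptws P1 -> discrete_topology P1}) @ G -->
      (HR_fun g : {ptws P1 -> discrete_topology P1}).
    apply/cvg_sup => x V /= [B [[C oC <-] /= Cg CV]].
    exists [:: x] => // h /(_ x (mem_head _ _)) hx.
    by apply: CV => /=; rewrite hx.
  move=> V [B [[C oC <-] /= Cg CV]].
  have /Gf : nbhs (HR_fun g : {ptws P1 -> discrete_topology P1}) C.
    exact: (open_nbhs_nbhs (conj oC Cg)).
  exact: (@filterS _ G GF _ _ CV).
have ev (x : P1) : nbhs g [set h : HR | h x = g x].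
  have c : continuous (fun h : HR => (h x : discrete_topology P1)).
    move=> h; apply: (@continuous_comp _ _ _
      (HR_fun : HR -> {ptws P1 -> discrete_topology P1}) (fun f => f x)).
      exact: initial_continuous.
    exact: (@proj_continuous _ (fun=> discrete_topology P1)).
  exact: (c g [set g x] (discrete_set1 (g x : discrete_topology P1))).
apply: (@filterS _ _ _ [set h : HR | {in F, h =1 g}]) => //.
elim: F {FU} => [|x F IH]; first by apply: filterE => h y.
apply: filterS2 (ev x) IH => h hx hF y; rewrite inE => /orP[/eqP->//|].
exact: hF.
Qed.

Lemma HR_mul_continuous : continuous (fun xy : HR * HR => (xy.1 * xy.2)%g).
Proof.
move=> [g h] U /HR_nbhsP[F FU] /=.
exists ([set g' : HR | {in map (HR_fun h) F, g' =1 HR_fun g}],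
  [set h' : HR | {in F, h' =1 HR_fun h}]).
  by split; apply/HR_nbhsP; [exists (map (HR_fun h) F)|exists F].
move=> [g' h'] /= [g'g h'h]; apply: FU => x xF /=.
by rewrite !HR_mulE h'h// g'g// map_f.
Qed.

Lemma HR_inv_continuous : continuous (fun x : HR => x^-1%g).
Proof.
move=> g U /HR_nbhsP[F FU]; apply/HR_nbhsP; exists (map (g^-1%g : HR) F) => h hg.
apply: FU => x xF; apply: (can_inj (HR_Vk h)).
by rewrite HR_VkV hg ?map_f// HR_VkV.
Qed.

HB.instance Definition _ := Group_isTopological.Build HR
  HR_mul_continuous HR_inv_continuous.

End HR.

(* finitely supported functions T -> A, as a discrete group *)
Section direct_sum.
Variables (T : choiceType) (A : groupType).

Definition direct_sum : Type := {fsfun T -> A with 1%g}.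

HB.instance Definition _ := Choice.on direct_sum.

Definition ds_fun (f : direct_sum) : T -> A := fun_of_fsfun f.
Coercion ds_fun : direct_sum >-> Funclass.

Definition ds_one : direct_sum := [fsfun with 1%g].

Definition ds_mul (f g : direct_sum) : direct_sum :=
  [fsfun x in (finsupp f `|` finsupp g)%fset => (f x * g x)%g | 1%g].

Definition ds_inv (f : direct_sum) : direct_sum :=
  [fsfun x in finsupp f => (f x)^-1%g | 1%g].

Lemma ds_eqP (f g : direct_sum) : f =1 g -> f = g.
Proof. by move/fsfunP. Qed.

Lemma ds_out (f : direct_sum) x : x \notin finsupp f -> f x = 1%g.
Proof. exact: fsfun_dflt. Qed.

Lemma ds_oneE x : ds_one x = 1%g.
Proof. exact: fsfun0E. Qed.

Lemma ds_mulE f g x : ds_mul f g x = (f x * g x)%g.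
Proof.
rewrite {1}/ds_fun fsfunE inE; case: ifPn => //.
by rewrite negb_or => /andP[/ds_out-> /ds_out->]; rewrite mulg1.
Qed.

Lemma ds_invE f x : ds_inv f x = (f x)^-1%g.
Proof. by rewrite {1}/ds_fun fsfunE; case: ifPn => // /ds_out->; rewrite invg1. Qed.

Lemma ds_mulA : associative ds_mul.
Proof. by move=> f g h; apply: ds_eqP => x; rewrite !ds_mulE mulgA. Qed.

Lemma ds_mul1 : left_id ds_one ds_mul.
Proof. by move=> f; apply: ds_eqP => x; rewrite ds_mulE ds_oneE mul1g. Qed.

Lemma ds_mulr1 : right_id ds_one ds_mul.
Proof. by move=> f; apply: ds_eqP => x; rewrite ds_mulE ds_oneE mulg1. Qed.

Lemma ds_mulV : left_inverse ds_one ds_inv ds_mul.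
Proof.
by move=> f; apply: ds_eqP => x; rewrite ds_mulE ds_invE ds_oneE mulVg.
Qed.

Lemma ds_mulrV : right_inverse ds_one ds_inv ds_mul.
Proof.
by move=> f; apply: ds_eqP => x; rewrite ds_mulE ds_invE ds_oneE mulgV.
Qed.

HB.instance Definition _ := isGroup.Build direct_sum
  ds_mulA ds_mul1 ds_mulr1 ds_mulV ds_mulrV.

HB.instance Definition _ :=
  Topological.copy direct_sum (discrete_topology direct_sum).

End direct_sum.

Section wreath_HR.
Variables (R : realType) (A : groupType).
Local Notation P1 := (P1 R).
Local Notation H := (HR R).
Local Notation dsum := (direct_sum P1 A).

(* (g . f)(x) = f (g^-1 x), see [ds_actE] *)
Definition ds_act (g : H) (f : dsum) : dsum :=
  [fsfun x in [fset g y | y in finsupp f]%fset => f ((g^-1%g : H) x) | 1%g].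

Lemma ds_actE g f x : ds_act g f x = f ((g^-1%g : H) x).
Proof.
rewrite {1}/ds_fun fsfunE; case: ifPn => // xf; rewrite ds_out//.
apply: contra xf => xf; apply/imfsetP.
by exists ((g^-1%g : H) x) => //; rewrite HR_VkV.
Qed.

(* An alias of the product type, with the product topology but with the group
   law of the semidirect product [direct_sum P1 A ><| HR R]. *)
Definition wreath_HR : Type := (dsum * H)%type.

HB.instance Definition _ := Choice.copy wreath_HR (dsum * H)%type.

Definition wr_one : wreath_HR := (1%g, 1%g).

Definition wr_mul (u v : wreath_HR) : wreath_HR :=
  ((u.1 * ds_act u.2 v.1)%g, (u.2 * v.2)%g).

Definition wr_inv (u : wreath_HR) : wreath_HR :=
  (ds_act u.2^-1%g u.1^-1%g, u.2^-1%g).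

Lemma ds_act1 f : ds_act 1%g f = f.
Proof. by apply: ds_eqP => x; rewrite ds_actE invg1. Qed.

Lemma ds_actM g h f : ds_act (g * h)%g f = ds_act g (ds_act h f).
Proof. by apply: ds_eqP => x; rewrite !ds_actE invgM. Qed.

Lemma ds_actD g f f' : ds_act g (f * f')%g = (ds_act g f * ds_act g f')%g.
Proof. by apply: ds_eqP => x; rewrite ds_actE !ds_mulE !ds_actE. Qed.

Lemma ds_act_one g : ds_act g 1%g = 1%g.
Proof. by apply: ds_eqP => x; rewrite ds_actE !ds_oneE. Qed.

Lemma wr_mulA : associative wr_mul.
Proof.
by move=> u v w; rewrite /wr_mul /= ds_actD -ds_actM !mulgA.
Qed.

Lemma wr_mul1 : left_id wr_one wr_mul.
Proof. by move=> [f g]; rewrite /wr_mul /= ds_act1 !mul1g. Qed.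

Lemma wr_mulr1 : right_id wr_one wr_mul.
Proof. by move=> [f g]; rewrite /wr_mul /= ds_act_one !mulg1. Qed.

Lemma wr_mulV : left_inverse wr_one wr_inv wr_mul.
Proof.
by move=> [f g]; rewrite /wr_mul /= -ds_actD !mulVg ds_act_one.
Qed.

Lemma wr_mulrV : right_inverse wr_one wr_inv wr_mul.
Proof.
by move=> [f g]; rewrite /wr_mul /= -ds_actM !mulgV ds_act1 mulgV.
Qed.

HB.instance Definition _ := isGroup.Build wreath_HR
  wr_mulA wr_mul1 wr_mulr1 wr_mulV wr_mulrV.

HB.instance Definition _ := Topological.copy wreath_HR (dsum * H)%type.

Lemma ds_act_local (g h : H) (f : dsum) :
  {in finsupp f, (h : P1 -> P1) =1 g} -> ds_act h f = ds_act g f.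
Proof.
move=> hg; apply: ds_eqP => x; rewrite !ds_actE.
have [hx|hx] := boolP ((h^-1%g : H) x \in finsupp f).
  congr (f _); apply: (can_inj (HR_Vk g)).
  by rewrite HR_VkV -hg// HR_VkV.
have [gx|gx] := boolP ((g^-1%g : H) x \in finsupp f).
  congr (f _); apply: (can_inj (HR_Vk h)).
  by rewrite HR_VkV hg// HR_VkV.
by rewrite !ds_out.
Qed.

Lemma wr_nbhsP (f : dsum) (g : H) (U : set wreath_HR) :
  nbhs ((f, g) : wreath_HR) U <->
  exists F : seq P1, forall h : H, {in F, (h : P1 -> P1) =1 g} -> U (f, h).
Proof.
split=> [[[V W] [/= Vf /HR_nbhsP[F FW]] VWU]|[F FU]].
  exists F => h hF; apply: VWU; split => /=; last exact: FW.
  exact: nbhs_singleton Vf.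
exists ([set f], [set h : H | {in F, (h : P1 -> P1) =1 g}]).
  by split=> /=; [exact: (discrete_set1 (f : discrete_topology dsum))
                 |apply/HR_nbhsP; exists F].
by move=> [_ h] [/= -> hF]; exact: FU.
Qed.

Lemma wr_mul_continuous :
  continuous (fun uv : wreath_HR * wreath_HR => (uv.1 * uv.2)%g).
Proof.
move=> [[f g] [f' g']] U /wr_nbhsP[F FU] /=.
exists ([set u : wreath_HR | u.1 = f /\
    {in map (g' : H) F ++ finsupp f', (u.2 : P1 -> P1) =1 (g : H)}],
  [set u : wreath_HR | u.1 = f' /\ {in F, (u.2 : P1 -> P1) =1 (g' : H)}]).
  split; apply/wr_nbhsP; first by exists (map (g' : H) F ++ finsupp f').
  by exists F.
move=> [[_ h] [_ h']] [[/= -> hg] [/= -> hg']] /=.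
change (U ((f * ds_act h f')%g, (h * h')%g)).
have -> : ds_act h f' = ds_act g f'.
  by apply: ds_act_local => x xf; apply: hg; rewrite mem_cat xf orbT.
apply: FU => x xF; rewrite !HR_mulE hg'// hg//.
by rewrite mem_cat map_f.
Qed.

Lemma wr_inv_continuous : continuous (fun u : wreath_HR => u^-1%g).
Proof.
move=> [f g] U /wr_nbhsP[F FU]; apply/wr_nbhsP.
pose E : seq P1 := F ++ finsupp (f^-1%g : dsum).
exists (map (g^-1%g : H) E) => h hg.
have hV : {in E, ((h^-1%g : H) : P1 -> P1) =1 (g^-1%g : H)}.
  move=> x xE; apply: (can_inj (HR_Vk h)).
  by rewrite HR_VkV hg ?map_f// HR_VkV.
change (U (ds_act h^-1%g f^-1%g, h^-1%g)).
have -> : ds_act h^-1%g f^-1%g = ds_act g^-1%g f^-1%g.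
  by apply: ds_act_local => x xf; apply: hV; rewrite mem_cat xf orbT.
by apply: FU => x xF; apply: hV; rewrite mem_cat xF.
Qed.

HB.instance Definition _ := Group_isTopological.Build wreath_HR
  wr_mul_continuous wr_inv_continuous.

End wreath_HR.

(* Main.v *)
Require Import Defs.
From HB Require Import structures.
From mathcomp Require Import all_boot all_order all_algebra.
From mathcomp Require Import finmap generic_quotient.
From mathcomp Require Import all_classical all_reals.
From mathcomp Require Import topology normedtype realfun.
From mathcomp Require Import ring lra zify.

Set Implicit Arguments.
Unset Strict Implicit.
Unset Printing Implicit Defensive.

Import Order.TTheory GRing.Theory Num.Theory.
Import numFieldNormedType.Exports.
Local Open Scope classical_set_scope.
Local Open Scope ring_scope.

Local Notation arc := Defs.arc.

(** Why the group is not skew-amenable.  Let [mu] be an invariant mean.  A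
    bounded function of an element [(f, g)] that depends on [f] only is left
    uniformly continuous whatever it is, because the elements [(1, h)] form a
    neighbourhood of the neutral element.  So [mu] gives a mean on all bounded
    functions of [f], invariant under the action of [H] and under the
    multiplications by finitely supported functions.  Record of [f] the finite
    set [s] of rational points of its support, in the affine chart of the
    projective line: this gives a mean on finite sets of rationals, invariant
    under the elements of [H] that preserve the rational points.  Multiplying
    [f] by a function supported at [q] makes [s] contain [q] with mass at least
    1/2; the union of four independent copies of [s] contains it with mass at
    least 15/16 ([mean_union_miss]).

    It remains to see that there is no such mean ([no_mean]).  A finite set cuts
    the line into gaps.  Give each gap the length of its trace on [0, 1], and
    sort the gaps into four classes by the reduction of their left endpoint in
    the projective line over F_3, whose points are 0, oo, 1 and -1.  The four
    weights so obtained add up to at most 1.  The group [H] contains the maps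
    [shrink], x |-> 3x/4, and [bend], which is x |-> (7x - 1) / (7 - x) on
    [1/7, 1] and a translation or the identity elsewhere.  The integer matrices
    of these two projective maps have rank one modulo 3, with kernels oo and 1
    and images 0 and -1.  Hence [shrink] sends every rational whose reduction
    is not oo into the class of 0, and [bend] sends every rational of [1/7, 1]
    whose reduction is not 1 into the class of -1 ([pingpong_shrink],
    [pingpong_bend]).  On the other hand both maps are so close to the identity
    that they lose little length.  So, for a set [s] that contains 0, 1/7 and 1,
    the weight of 0 in [shrink s] plus the weight of oo in [s] is at least 3/4,
    and so is the weight of -1 in [bend s] plus the weight of 1 in [s]
    ([weight_shrink], [weight_bend]).  Taking means, which are invariant, the
    four weights have total mean at least 2 (3/4 - 2/16) > 1, a contradiction.

    The length that is almost preserved lives on the real line, and the ping-pong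
    at the prime 3; labelling a gap by its left endpoint, which moves with the
    gap, is what connects the two. *)

(** * Truncation to an interval *)

Section Clamp.
Variable F : realFieldType.
Implicit Types l h x y : F.

Definition clamp l h x := Num.max l (Num.min h x).

Lemma clamp_homo l h : {homo clamp l h : x y / x <= y}.
Proof.
by move=> x y; rewrite /clamp /Num.max /Num.min; do ![case: ifP] => *; lra.
Qed.

Lemma clamp_lo l h x : l <= h -> x <= l -> clamp l h x = l.
Proof. by rewrite /clamp /Num.max /Num.min => ? ?; do ![case: ifP] => *; lra. Qed.

Lemma clamp_hi l h x : l <= h -> h <= x -> clamp l h x = h.
Proof. by rewrite /clamp /Num.max /Num.min => ? ?; do ![case: ifP] => *; lra. Qed.

Lemma clamp_id l h x : l <= x -> x <= h -> clamp l h x = x.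
Proof. by rewrite /clamp /Num.max /Num.min => ? ?; do ![case: ifP] => *; lra. Qed.

Lemma clamp_ge l h x : l <= clamp l h x.
Proof. by rewrite /clamp /Num.max /Num.min; do ![case: ifP] => *; lra. Qed.

Lemma clamp_le l h x : l <= h -> clamp l h x <= h.
Proof. by rewrite /clamp /Num.max /Num.min => ?; do ![case: ifP] => *; lra. Qed.

End Clamp.

(** * The projective line over F_3, and two moves of the line *)

(** The reduction of [q] modulo 3 is the zero of the linear form a X + b Y.  The
    coefficients (1, 0), (0, 1), (1, -1), (1, 1) single out the reductions
    0, oo, 1, -1 respectively. *)
Definition mod3_root (a b : int) (q : rat) : bool :=
  (3 %| a * numq q + b * denq q)%Z.

(** The reduction can be read off any fraction whose terms are not both divisible
    by 3: such a fraction is obtained from the reduced one by a factor prime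
    to 3. *)
Lemma mod3_root_frac (a b m n : int) (q : rat) : n != 0 -> q * n%:Q = m%:Q ->
  ~~ ((3 %| m)%Z && (3 %| n)%Z) -> mod3_root a b q = (3 %| a * m + b * n)%Z.
Proof.
move=> n0 qE mn3.
have mE : m * denq q = n * numq q.
  apply: (@intr_inj rat); rewrite !rmorphM /= -qE numqE; ring.
have dn : (denq q %| n)%Z.
  rewrite -(@Gauss_dvdzl (denq q) n (numq q)).
    by rewrite -mE dvdz_mull.
  by rewrite coprimez_sym /coprimez /gcdz; exact: coprime_num_den.
have [k nE] := dvdzP dn.
have d0 : denq q != 0 := denq_neq0 q.
have mE' : m = k * numq q.
  by apply: (mulIf d0); rewrite mE nE; ring.
have k3 : coprimez 3 k.
  rewrite coprimezE prime_coprime//; apply: contra mn3 => k3.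
  by rewrite mE' nE !dvdz_mulr.
have -> : a * m + b * n = k * (a * numq q + b * denq q) by rewrite mE' nE; ring.
by rewrite Gauss_dvdzr.
Qed.

(** By Cramer's rule, two independent linear forms vanishing at the reduction
    would make 3 divide both the numerator and the denominator. *)
Lemma mod3_root_excl (a b a' b' : int) (q : rat) :
  ~~ (3 %| a * b' - a' * b)%Z -> mod3_root a b q -> ~~ mod3_root a' b' q.
Proof.
rewrite /mod3_root => d3 h; apply/negP => h'.
have := coprime_num_den q.
set u := numq q in h h' *; set v := denq q in h h' *.
have d : coprimez 3 (a * b' - a' * b).
  by rewrite coprimezE prime_coprime//.
have uv : (3 %| u)%Z && (3 %| v)%Z.
  rewrite -(Gauss_dvdzr u d) -(Gauss_dvdzr v d); apply/andP; split.
    have -> : (a * b' - a' * b) * u =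
      b' * (a * u + b * v) - b * (a' * u + b' * v) by ring.
    by rewrite rpredB// dvdz_mull.
  have -> : (a * b' - a' * b) * v =
    a * (a' * u + b' * v) - a' * (a * u + b * v) by ring.
  by rewrite rpredB// dvdz_mull.
move: uv => /andP[u3 v3] /eqP c.
have : (3 %| gcdn `|u| `|v|)%N by rewrite dvdn_gcd; apply/andP.
by rewrite c.
Qed.

Lemma mod3_root_disjoint q :
  (mod3_root 1 0 q + mod3_root 0 1 q + mod3_root 1 1 q +
   mod3_root 1 (-1) q <= 1)%N.
Proof.
have ex (a b a' b' : int) := @mod3_root_excl a b a' b' q.
have := (ex 1 0 0 1 isT, ex 1 0 1 1 isT, ex 1 0 1 (-1) isT, ex 0 1 1 1 isT,
  ex 0 1 1 (-1) isT, ex 1 1 1 (-1) isT).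
case: (mod3_root 1 0 q); case: (mod3_root 0 1 q); case: (mod3_root 1 1 q);
  by case: (mod3_root 1 (-1) q) => //= -[[[[[h1 h2] h3] h4] h5] h6]; exfalso;
  do ?[by have := h1 isT|by have := h2 isT|by have := h3 isT|
       by have := h4 isT|by have := h5 isT|by have := h6 isT].
Qed.

Section Moves.
Variable F : realFieldType.
Implicit Types x y : F.

Definition shrink (x : F) := 3 / 4 * x.

(** The middle piece is conjugate to [shrink]: its fixed points are -1 and 1
    instead of 0 and oo.  It maps 1/7 to 0, so a translation continues it on the
    left, and the identity continues it on the right. *)
Definition bend (x : F) :=
  if x < 7^-1 then x - 7^-1 else if x <= 1 then (7 * x - 1) / (7 - x) else x.

Lemma shrink_mono : {homo shrink : x y / x < y}.
Proof. by move=> x y; rewrite /shrink => ?; lra. Qed.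

Lemma shrink_clamp x y : x <= y ->
  3 / 4 * (clamp 0 1 y - clamp 0 1 x) <=
    clamp 0 1 (shrink y) - clamp 0 1 (shrink x).
Proof.
(* The excess over the linear bound is again a truncation, hence monotone. *)
have D z : clamp 0 1 (shrink z) - 3 / 4 * clamp 0 1 z =
    clamp (3 / 4) 1 (shrink z) - 3 / 4.
  by rewrite /shrink /clamp /Num.max /Num.min; do ![case: ifP] => *; lra.
move=> xy; have := @clamp_homo F (3 / 4) 1 (shrink x) (shrink y).
have -> : shrink x <= shrink y by rewrite /shrink; lra.
move=> /(_ isT); have := D x; have := D y; lra.
Qed.

(** The derivative is 48 / (7 - x) ^ 2, and 49 bounds the denominator. *)
Lemma bend_expansion x y : 7^-1 <= x -> x < y -> y <= 1 ->
  48 / 49 * (y - x) <= (7 * y - 1) / (7 - y) - (7 * x - 1) / (7 - x).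
Proof.
move=> x7 xy y1.
have -> : (7 * y - 1) / (7 - y) - (7 * x - 1) / (7 - x) =
  48 * (y - x) / ((7 - y) * (7 - x)) by field; apply/andP; split; lra.
have d0 : 0 < (7 - y) * (7 - x) by apply: mulr_gt0; lra.
rewrite ler_pdivlMr// mulrAC -subr_ge0.
have -> : 48 * (y - x) - 48 / 49 * ((7 - y) * (7 - x)) * (y - x) =
  (48 / 49) * (y - x) * (7 * x + 7 * y - x * y) by field.
apply: mulr_ge0; first by apply: mulr_ge0; lra.
have : 0 <= x * (1 - y) by apply: mulr_ge0; lra.
lra.
Qed.

Lemma bend_itv x : 7^-1 <= x <= 1 -> 0 <= (7 * x - 1) / (7 - x) <= 1.
Proof.
move=> /andP[x7 x1]; rewrite divr_ge0; [|lra..].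
by rewrite ler_pdivrMr; lra.
Qed.

Lemma bend_mono : {homo bend : x y / x < y}.
Proof.
move=> x y xy; rewrite /bend.
have := @bend_itv x; have := @bend_itv y; have := @bend_expansion x y.
set X := _ / (7 - x); set Y := _ / (7 - y).
case: (ltP x 7^-1) => x7; case: (ltP y 7^-1) => y7; case: (leP x 1) => x1;
  case: (leP y 1) => y1 //=.
all: try lra.
all: try by move=> _ /(_ isT) /andP[? ?]; lra.
all: try by move=> _ _ /(_ isT) /andP[? ?]; lra.
Qed.

End Moves.

(** Modulo 3 the matrix diag(3, 4) has kernel oo and image 0. *)
Lemma pingpong_shrink q : ~~ mod3_root 0 1 q -> mod3_root 1 0 (shrink q).
Proof.
rewrite {1}/mod3_root mul0r add0r mul1r => v3.
have v0 := denq_neq0 q.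
rewrite (@mod3_root_frac _ _ (3 * numq q) (4 * denq q)).
- by rewrite mul0r addr0 mul1r dvdz_mulr.
- by rewrite mulf_neq0.
- by rewrite /shrink !rmorphM /= (_ : 3%:~R = 3)// (_ : 4%:~R = 4)// numqE; field.
- by rewrite negb_and; apply/orP; right; rewrite Gauss_dvdzr.
Qed.

(** Modulo 3 the matrix with rows (7, -1) and (-1, 7) has kernel 1 and
    image -1. *)
Lemma pingpong_bend q :
  7^-1 <= q <= 1 -> ~~ mod3_root 1 (-1) q -> mod3_root 1 1 (bend q).
Proof.
move=> /andP[q7 q1]; rewrite {1}/mod3_root => n3.
have v0 := denq_neq0 q.
have v0' : (denq q)%:Q != 0 by rewrite intr_eq0.
rewrite /bend ltNge q7 q1 /=.
rewrite (@mod3_root_frac _ _ (7 * numq q - denq q) (7 * denq q - numq q)).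
- rewrite !mul1r (_ : _ + _ = 3 * (2 * (numq q + denq q))) ?dvdz_mulr//; ring.
- apply/eqP => e; have := numqE q.
  rewrite (_ : numq q = 7 * denq q) ?rmorphM /=; last by lia.
  move=> /(mulIf v0') q7'; move: q1; rewrite -q7'; lia.
- rewrite !rmorphB !rmorphM /= (_ : 7%:~R = 7)// numqE; field; lra.
- rewrite negb_and; apply/orP; left.
  rewrite (_ : _ - _ = 3 * (2 * numq q) + (1 * numq q + (-1) * denq q)); last ring.
  by rewrite rpredDl// dvdz_mulr.
Qed.

Lemma ratr_shrink (F : realFieldType) (q : rat) :
  ratr (shrink q) = shrink (ratr q) :> F.
Proof. by rewrite /shrink !(rmorphM, fmorphV) /= !ratr_nat. Qed.

Lemma ratr_bend (F : realFieldType) (q : rat) :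
  ratr (bend q) = bend (ratr q) :> F.
Proof.
rewrite /bend -(ltr_rat F) -(ler_rat F) fmorphV /= ratr_nat rmorph1.
case: ifP => _; first by rewrite rmorphB fmorphV /= ratr_nat.
case: ifP => _ //.
by rewrite rmorphM fmorphV !rmorphB rmorphM /= !ratr_nat rmorph1.
Qed.

(** * Weights of the gaps of a finite set *)

Section Weight.
Variable F : realFieldType.
Implicit Types (T : pred rat) (L : seq rat).

Definition clamp_step (l h : F) L i : F :=
  clamp l h (ratr L`_i.+1) - clamp l h (ratr L`_i).

(** The label of a gap is its left endpoint, which an increasing map carries to
    the label of the image gap; truncated lengths telescope. *)
Definition weight T L : F :=
  \sum_(0 <= i < (size L).-1) if T L`_i then clamp_step 0 1 L i else 0.

Lemma sorted_consecutive L i :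
  sorted <%R L -> (i < (size L).-1)%N -> L`_i < L`_i.+1.
Proof.
move=> sL iL; have iL' : (i.+1 < size L)%N by case: (size L) iL.
by rewrite (sorted_ltn_nth lt_trans 0 sL) ?inE// ltnW.
Qed.

Lemma clamp_step_ge0 (l h : F) L i : sorted <%R L -> (i < (size L).-1)%N ->
  0 <= clamp_step l h L i.
Proof.
by move=> sL iL; rewrite subr_ge0 clamp_homo// ler_rat ltW// sorted_consecutive.
Qed.

Lemma sorted_gap L i z : sorted <%R L -> z \in L -> (i < (size L).-1)%N ->
  z <= L`_i \/ L`_i.+1 <= z.
Proof.
move=> sL /(nthP 0)[j jL <-] iL; have iL' : (i.+1 < size L)%N by case: (size L) iL.
have sL' : sorted <=%R L by apply: sub_sorted sL => x y; exact: ltW.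
have nle := sorted_leq_nth le_trans le_refl 0 sL'.
case: (leqP j i) => ji; [left|right]; apply: nle; rewrite ?inE//.
exact: ltnW.
Qed.

(** The gaps of a set that contains both ends of an interval tile the interval. *)
Lemma sum_clamp_step (l h : rat) L :
  sorted <%R L -> l <= h -> l \in L -> h \in L ->
  \sum_(0 <= i < (size L).-1) clamp_step (ratr l) (ratr h) L i =
  ratr h - ratr l.
Proof.
move=> sL lh lL hL.
have sL' : sorted <=%R L by apply: sub_sorted sL => x y; exact: ltW.
have nle := sorted_leq_nth le_trans le_refl 0 sL'.
have L0 : (0 < size L)%N by case: (L) lL.
rewrite (telescope_sumr (fun i => clamp _ _ (ratr L`_i)))//.
rewrite clamp_hi ?clamp_lo ?ler_rat//.
  by case/(nthP 0): lL => j jL <-; apply: nle; rewrite ?inE.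
case/(nthP 0): hL => j jL <-; apply: nle; rewrite ?inE ?prednK//.
by rewrite -ltnS prednK.
Qed.

Lemma weight_ge0 T L : sorted <%R L -> 0 <= weight T L.
Proof.
move=> sL; rewrite /weight big_nat sumr_ge0// => i /andP[_ iL].
by case: ifP => // _; exact: clamp_step_ge0.
Qed.

(** A gap is counted in at most one of the four classes, and together the gaps
    cover no more than [0, 1]. *)
Lemma weight_disjoint T1 T2 T3 T4 L : sorted <%R L ->
  (forall q, T1 q + T2 q + T3 q + T4 q <= 1)%N ->
  weight T1 L + weight T2 L + weight T3 L + weight T4 L <= 1.
Proof.
move=> sL dT; rewrite /weight -!big_split /=.
apply: (@le_trans _ _ (\sum_(0 <= i < (size L).-1) clamp_step 0 1 L i)).
  apply: ler_sum_nat => i /andP[_ iL]; have := clamp_step_ge0 0 1 sL iL.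
  by have := dT L`_i; do 4![case: (_ L`_i)] => //= _ ?; lra.
rewrite (telescope_sumr (fun i => clamp _ _ (ratr L`_i)))//.
have := @clamp_ge F 0 1 (ratr L`_0).
have := @clamp_le F 0 1 (ratr L`_(size L).-1) ler01.
lra.
Qed.

Lemma weight_map T T' (g : rat -> rat) L :
  weight T (map g L) + weight T' L =
  \sum_(0 <= i < (size L).-1)
    ((if T (g L`_i) then
        clamp 0 1 (ratr (g L`_i.+1)) - clamp 0 1 (ratr (g L`_i))
      else 0) + (if T' L`_i then clamp_step 0 1 L i else 0)).
Proof.
rewrite big_split /= /weight size_map; congr (_ + _).
apply: eq_big_nat => i /andP[_ iL].
by rewrite /clamp_step !(nth_map 0)//; case: (size L) iL => //= n /ltnW.
Qed.

(** A gap whose left endpoint reduces to oo counts in the second term; any other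
    is carried to a gap of class 0, which counts in the first and has kept 3/4
    of its length. *)
Lemma weight_shrink L : sorted <%R L -> 0 \in L -> 1 \in L ->
  3 / 4 <= weight (mod3_root 1 0) (map (@shrink rat) L) +
    weight (mod3_root 0 1) L.
Proof.
move=> sL L0 L1.
rewrite weight_map.
have := sum_clamp_step sL ler01 L0 L1; rewrite rmorph0 rmorph1 subr0 => tel.
rewrite -[leLHS]mulr1 -[X in _ * X <= _]tel mulr_sumr.
apply: ler_sum_nat => i /andP[_ iL].
have cxy := clamp_step_ge0 0 1 sL iL.
have axy : 3 / 4 * clamp_step 0 1 L i <= clamp 0 1 (ratr (shrink L`_i.+1)) -
    clamp 0 1 (ratr (shrink L`_i)).
  by rewrite !ratr_shrink shrink_clamp// ler_rat ltW// sorted_consecutive.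
case: (boolP (mod3_root 0 1 L`_i)) => h; first by case: ifP => _; lra.
by rewrite pingpong_shrink// addr0.
Qed.

(** Same argument, with the gaps inside [1/7, 1]: there [bend] is projective and
    keeps 48/49 of the length, and 48/49 times 6/7 exceeds 3/4.  The points 1/7
    and 1 are required in [L] so that no gap crosses the ends of this interval. *)
Lemma weight_bend L : sorted <%R L -> 7^-1 \in L -> 1 \in L ->
  3 / 4 <= weight (mod3_root 1 1) (map (@bend rat) L) +
    weight (mod3_root 1 (-1)) L.
Proof.
move=> sL L7 L1; rewrite weight_map.
have r7 : ratr 7^-1 = 7^-1 :> F by rewrite fmorphV /= ratr_nat.
have := sum_clamp_step sL (_ : 7^-1 <= 1) L7 L1.
move=> /(_ isT); rewrite rmorph1 r7 => tel.
apply: (@le_trans _ _ (48 / 49 * (1 - 7^-1))); first by lra.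
rewrite -tel mulr_sumr; apply: ler_sum_nat => i /andP[_ iL].
have xy : ratr L`_i < ratr L`_i.+1 :> F by rewrite ltr_rat sorted_consecutive.
have h7 : 7^-1 <= ratr L`_i :> F \/ ratr L`_i.+1 <= 7^-1 :> F.
  by rewrite -r7 !ler_rat; exact: sorted_gap.
have h1 : 1 <= ratr L`_i :> F \/ ratr L`_i.+1 <= 1 :> F.
  by rewrite -(rmorph1 (@ratr F)) !ler_rat; exact: sorted_gap.
have pp : 7^-1 <= ratr L`_i :> F -> ratr L`_i <= 1 :> F ->
    ~~ mod3_root 1 (-1) L`_i -> mod3_root 1 1 (bend L`_i).
  rewrite -r7 -(rmorph1 (@ratr F)) !ler_rat => h h'.
  by apply: pingpong_bend; rewrite h h'.
rewrite /clamp_step !ratr_bend.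
move: (mod3_root 1 1 _) (mod3_root 1 (-1) _) pp => b1 b2.
move: (ratr L`_i) (ratr L`_i.+1) xy h7 h1 => x y xy h7 h1 pp.
have cxy : clamp 0 1 x <= clamp 0 1 y by rewrite clamp_homo// ltW.
have gxy : clamp 0 1 (bend x) <= clamp 0 1 (bend y).
  by rewrite clamp_homo// ltW// bend_mono.
(* Gaps outside [1/7, 1] contribute nothing to the left-hand side. *)
case: h7 => [x7|y7]; last first.
  rewrite !(@clamp_lo _ (7^-1) 1)//; [|lra..].
  by rewrite subrr mulr0 addr_ge0//; case: ifP => _ //; rewrite subr_ge0.
case: h1 => [x1|y1].
  rewrite !(@clamp_hi _ (7^-1) 1)//; [|lra..].
  by rewrite subrr mulr0 addr_ge0//; case: ifP => _ //; rewrite subr_ge0.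
have x1 : x <= 1 := le_trans (ltW xy) y1.
have y7 : 7^-1 <= y := le_trans x7 (ltW xy).
rewrite !(clamp_id x7, clamp_id y7)//.
rewrite x7 x1 in pp.
case: b2 pp => [_|/(_ isT isT isT) ->].
  rewrite (@clamp_id _ 0 1 x)//; last lra.
  rewrite (@clamp_id _ 0 1 y)//; last lra.
  by case: ifP => _; lra.
rewrite addr0.
have := @bend_itv _ x; rewrite x7 x1 => /(_ isT) /andP[? ?].
have := @bend_itv _ y; rewrite y7 y1 => /(_ isT) /andP[? ?].
rewrite /bend !ltNge x7 x1 y7 y1 /= !(@clamp_id _ 0 1)//.
exact: bend_expansion.
Qed.

End Weight.

(** * Means on bounded functions *)

Section Mean.
Variable R : realType.

(** A mean is defined on all functions, with conditions on the bounded ones only: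
    thus it applies to any expression, and boundedness is a side condition. *)
Record mean (T : Type) (m : (T -> R) -> R) : Prop := Mean {
  mean_linear : forall (k : R) (F G : T -> R),
    F \in bfun R T -> G \in bfun R T ->
    m (fun x => k * F x + G x) = k * m F + m G;
  mean_ge0 : forall F : T -> R, F \in bfun R T ->
    (forall x, 0 <= F x) -> 0 <= m F;
  mean_cst1 : m (fun=> 1) = 1 }.

Lemma bfun_comp (T U : Type) (e : T -> U) (F : U -> R) :
  F \in bfun R U -> F \o e \in bfun R T.
Proof. by move=> /bfunP[M FM]; apply/bfunP; exists M => x; exact: FM. Qed.

Section Theory.
Variables (T : Type) (m : (T -> R) -> R).
Hypothesis mm : mean m.
Implicit Types F G : T -> R.

Lemma bfun_itv (a b : R) F : (forall x, a <= F x <= b) -> F \in bfun R T.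
Proof.
move=> h; apply/bfunP; exists (`|a| + `|b|) => x; have /andP[h1 h2] := h x.
have := ler_norm b; have := ler_norm (- a); rewrite normrN => ha hb.
have := normr_ge0 a; have := normr_ge0 b => b0 a0.
by rewrite ler_norml; apply/andP; split; lra.
Qed.

Lemma bfun_lin (k : R) F G : F \in bfun R T -> G \in bfun R T ->
  (fun x => k * F x + G x) \in bfun R T.
Proof. by move=> bF bG; exact: (bfun_submod_closed R T).2. Qed.

Lemma bfunD F G : F \in bfun R T -> G \in bfun R T ->
  (fun x => F x + G x) \in bfun R T.
Proof. by move=> bF bG; exact: (rpredD bF bG). Qed.

Lemma mean0 : m (fun=> 0) = 0.
Proof.
have b0 : (fun=> 0) \in bfun R T by exact: bfun_cst.
have := mean_linear mm 1 b0 b0; rewrite /= mulr0 addr0; lra.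
Qed.

Lemma meanD F G : F \in bfun R T -> G \in bfun R T ->
  m (fun x => F x + G x) = m F + m G.
Proof.
move=> bF bG; rewrite -[m F]mul1r -mean_linear//.
by congr m; apply/funext => x; rewrite mul1r.
Qed.

Lemma meanZ k F : F \in bfun R T -> m (fun x => k * F x) = k * m F.
Proof.
move=> bF; rewrite -[RHS]addr0 -mean0 -mean_linear//; last exact: bfun_cst.
by congr m; apply/funext => x; rewrite addr0.
Qed.

Lemma mean_cst k : m (fun=> k) = k.
Proof.
have b1 : (fun=> 1) \in bfun R T by exact: bfun_cst.
rewrite -[RHS]mulr1 -(mean_cst1 mm) -meanZ//.
by rewrite /= mulr1.
Qed.

Lemma mean_le F G : F \in bfun R T -> G \in bfun R T ->
  (forall x, F x <= G x) -> m F <= m G.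
Proof.
move=> bF bG FG; rewrite -subr_ge0 addrC -mulN1r -mean_linear//.
apply: mean_ge0 => // [|x]; first exact: bfun_lin.
by rewrite mulN1r addrC subr_ge0.
Qed.

Lemma mean_norm (M : R) F : (forall x, `|F x| <= M) -> `|m F| <= M.
Proof.
move=> FM; have bF : F \in bfun R T by apply/bfunP; exists M.
have bM k : (fun=> k) \in bfun R T by exact: bfun_cst.
rewrite ler_norml -[X in X <= _]mean_cst -[X in _ && (_ <= X)]mean_cst.
by apply/andP; split; apply: mean_le => // x; have := FM x;
  rewrite ler_norml => /andP[].
Qed.

End Theory.

Lemma mean_map (T U : Type) (e : T -> U) (m : (T -> R) -> R) : mean m ->
  mean (fun F : U -> R => m (F \o e)).
Proof.
move=> mm; split; last exact: mean_cst1 mm.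
- by move=> k F G bF bG; rewrite -mean_linear//; exact: bfun_comp.
- move=> F bF F0; apply: (mean_ge0 mm) => [|x /=]; last exact: F0.
  exact: bfun_comp.
Qed.

Section Union.
Variables (K : choiceType).
Local Notation S := {fset K}.
Implicit Types (m : (S -> R) -> R) (F : S -> R).

(** Law of the union of two independent random finite sets of laws [m] and [m'].
    The order of the two integrations matters for finitely additive means. *)
Definition mean_union m m' F := m (fun s => m' (fun t => F (s `|` t)%fset)).

Lemma bfun_inner m' F : mean m' -> F \in bfun R S ->
  (fun s => m' (fun t => F (s `|` t)%fset)) \in bfun R S.
Proof.
move=> mm' /bfunP[M FM]; apply/bfunP; exists M => x.
by apply: (mean_norm mm') => y; exact: FM.
Qed.

Lemma mean_unionP m m' : mean m -> mean m' -> mean (mean_union m m').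
Proof.
move=> mm mm'; have bi F s : F \in bfun R S ->
    (fun t => F (s `|` t)%fset) \in bfun R S by exact: bfun_comp.
split.
- move=> k F G bF bG; rewrite /mean_union -(mean_linear mm);
    [|exact: bfun_inner mm' bF|exact: bfun_inner mm' bG].
  by congr m; apply/funext => s; rewrite (mean_linear mm')//; exact: bi.
- move=> F bF F0; apply: (mean_ge0 mm) => [|x]; first exact: (bfun_inner mm').
  by apply: (mean_ge0 mm') => //; exact: bi.
- rewrite /mean_union -[RHS](mean_cst1 mm); congr m; apply/funext => s.
  exact: mean_cst1 mm'.
Qed.

Definition miss (q : K) (s : S) : R := (q \notin s)%:R.

Lemma bfun_miss q : miss q \in bfun R S.
Proof. by apply: (@bfun_itv _ 0 1) => s; rewrite ler0n lern1 leq_b1. Qed.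

(** Independence: this is how the probability of missing a point is made small. *)
Lemma mean_union_miss m m' q : mean m -> mean m' ->
  mean_union m m' (miss q) = m (miss q) * m' (miss q).
Proof.
move=> mm mm'.
have bm := bfun_miss q.
rewrite mulrC -(meanZ mm)//; congr m; apply/funext => s.
rewrite mulrC -(meanZ mm')//; congr m'; apply/funext => t.
by rewrite /miss in_fsetU negb_or -mulnb natrM.
Qed.

Definition image_invariant (g : K -> K) m := forall F, F \in bfun R S ->
  m (fun s => F (g @` s)%fset) = m F.

Lemma mean_union_image_invariant g m m' : mean m' ->
  image_invariant g m -> image_invariant g m' ->
  image_invariant g (mean_union m m').
Proof.
move=> mm' im im' F bF; rewrite /mean_union.
rewrite -(im (fun s => m' (fun t => F (s `|` t)%fset)));
  last exact: (bfun_inner mm' bF).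
congr m; apply/funext => s.
rewrite -(im' (fun t => F (g @` s `|` t)%fset)).
  by congr m'; apply/funext => t; rewrite imfsetU.
exact: bfun_comp.
Qed.

End Union.

(** * No mean on finite sets of rationals is invariant under both moves *)

Section NoMean.
Local Notation S := {fset rat}.

Definition gap_weight (T : pred rat) (s : S) : R :=
  weight R T (sort <=%R s).

Lemma sorted_fset (s : S) : sorted <%R (sort <=%R s).
Proof. by rewrite sort_lt_sorted fset_uniq. Qed.

Lemma mem_sorted q (s : S) : q \in s -> q \in sort <=%R s.
Proof. by rewrite mem_sort. Qed.

Lemma gap_weight_imfset (g : rat -> rat) T (s : S) : {homo g : x y / x < y} ->
  gap_weight T (g @` s)%fset = weight R T (map g (sort <=%R s)).
Proof.
move=> gm; congr weight; apply: lt_sorted_eq; first exact: sorted_fset.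
  exact: (homo_sorted gm _ (sorted_fset s)).
move=> x; rewrite mem_sort; apply/imfsetP/mapP => -[y ys ->]; exists y => //;
  by move: ys; rewrite mem_sort.
Qed.

(** The lower bounds on the weights hold only for sets that contain two prescribed
    points; for the others, the sum of the indicators [miss] makes up for the
    missing 3/4, at a cost of at most 2/16 in the mean. *)
Lemma no_mean (m : (S -> R) -> R) : mean m ->
  image_invariant (@shrink rat) m -> image_invariant (@bend rat) m ->
  (forall q, m (miss q) <= 1 / 16) -> False.
Proof.
move=> mm ia ib ms.
pose W := gap_weight.
have W0 T s : 0 <= W T s by apply: weight_ge0; exact: sorted_fset.
have sumW s : W (mod3_root 1 0) s + W (mod3_root 0 1) s +
    W (mod3_root 1 1) s + W (mod3_root 1 (-1)) s <= 1.
  by apply: weight_disjoint; [exact: sorted_fset|exact: mod3_root_disjoint].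
have bW T : W T \in bfun R S.
  apply: (@bfun_itv _ 0 1) => s; rewrite W0 /=.
  have := @weight_disjoint R T pred0 pred0 pred0 _ (sorted_fset s).
  move=> /(_ _)/(le_trans _); apply; last by move=> q; case: (T q).
  rewrite -[leLHS]/(weight R T (sort <=%R s)) -!addrA lerDl.
  by rewrite !addr_ge0// weight_ge0// sorted_fset.
have bWg T (g : rat -> rat) : (fun s : S => W T (g @` s)%fset) \in bfun R S.
  exact: bfun_comp (bW T).
have bm q := bfun_miss (q : rat).
have key (g : rat -> rat) T T' p q : {homo g : x y / x < y} ->
    image_invariant g m -> (forall s : S, p \in s -> q \in s ->
      3 / 4 <= weight R T (map g (sort <=%R s)) + weight R T' (sort <=%R s)) ->
    5 / 8 <= m (W T) + m (W T').
  move=> gm ig h.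
  have h' (s : S) : 3 / 4 <= W T (g @` s)%fset + W T' s + (miss p s + miss q s).
    have [ps|ps] := boolP (p \in s); have [qs|qs] := boolP (q \in s); last first.
    1-3: rewrite /miss ps qs /= ?mulr0n ?mulr1n.
    1-3: by have := W0 T (g @` s)%fset; have := W0 T' s; lra.
    rewrite /W gap_weight_imfset//=; rewrite (le_trans (h s ps qs))// lerDl.
    by rewrite addr_ge0 ?ler0n.
  have : 3 / 4 <= m (fun s : S =>
      W T (g @` s)%fset + W T' s + (miss p s + miss q s)).
    rewrite -[X in X <= _](mean_cst mm).
    apply: (mean_le mm) => //; first exact: bfun_cst.
    by do ![apply: bfunD => //].
  rewrite (meanD mm); [|by do ![apply: bfunD => //]..].
  rewrite !(meanD mm)// ig//; have := ms p; have := ms q; lra.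
have ka := key _ _ _ 0 1 (@shrink_mono rat) ia (fun (s : S) h h' =>
  weight_shrink R (sorted_fset s) (mem_sorted h) (mem_sorted h')).
have kb := key _ _ _ 7^-1 1 (@bend_mono rat) ib (fun (s : S) h h' =>
  weight_bend R (sorted_fset s) (mem_sorted h) (mem_sorted h')).
have : m (fun s : S => W (mod3_root 1 0) s + W (mod3_root 0 1) s +
    W (mod3_root 1 1) s + W (mod3_root 1 (-1)) s) <= 1.
  rewrite -[X in _ <= X](mean_cst mm); apply: (mean_le mm) => //.
    by do ![apply: bfunD => //].
  exact: bfun_cst.
rewrite !(meanD mm)//; do ?[by do ![apply: bfunD => //]].
rewrite /W in ka kb *; lra.
Qed.

End NoMean.
End Mean.

(** * Piecewise projective maps are continuous *)

Lemma mem_seq3 (T : eqType) (a b c : T) (s := [:: a; b; c]) :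
  [/\ a \in s, b \in s & c \in s].
Proof. by split; rewrite !inE eqxx ?orbT. Qed.

Lemma cV2_eqP (R : realType) (u v : 'cV[R]_2) :
  u 0 0 = v 0 0 -> u 1 0 = v 1 0 -> u = v.
Proof.
move=> e0 e1; apply/colP => k; have [->|->//] : k = 0 \/ k = 1; rewrite //.
by case: k => -[|[|//]] hi; [left|right]; exact: val_inj.
Qed.

Lemma cV2_eq0 (R : realType) (v : 'cV[R]_2) : v 0 0 = 0 -> v 1 0 = 0 -> v = 0.
Proof. by move=> e0 e1; apply: cV2_eqP; rewrite mxE. Qed.

(** Continuity is checked on the circle, through homogeneous coordinates; the
    circle enters only through the continuity of the coordinates of [e]. *)
Section ContinuousForms.
Variables (R : realType) (X : topologicalType) (e : X -> 'cV[R]_2).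
Hypothesis ec : forall i, continuous (fun x => e x i 0).

Lemma continuous_linear_form (a b : R) :
  continuous (fun x => a * e x 0 0 + b * e x 1 0).
Proof.
by move=> x; apply: cvgD; apply: cvgM; (exact: cvg_cst || exact: ec).
Qed.

Lemma continuous_wedge (u : 'cV[R]_2) : continuous (fun x => wedge u (e x)).
Proof.
rewrite (_ : (fun x => _) = fun x => - u 1 0 * e x 0 0 + u 0 0 * e x 1 0).
  exact: continuous_linear_form.
by apply/funext => x; rewrite /wedge; ring.
Qed.

Lemma continuous_wedgeM (u v : 'cV[R]_2) (w : R) :
  continuous (fun x => wedge u (e x) * wedge (e x) v * w).
Proof.
move=> x; apply: cvgM; last exact: cvg_cst.
apply: cvgM; first exact: continuous_wedge.
rewrite wedgeC; under eq_fun do rewrite wedgeC.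
by apply: cvgN; exact: continuous_wedge.
Qed.

Lemma continuous_normalize (A : 'M[R]_2) i : (forall x, A *m e x != 0) ->
  continuous (fun x => (Num.sqrt ((A *m e x) 0 0 ^+ 2 + (A *m e x) 1 0 ^+ 2))^-1 *
    (A *m e x) i 0).
Proof.
move=> Ae0; have Ac k : continuous (fun x => (A *m e x) k 0).
  rewrite (_ : (fun v => _) = fun x => A k 0 * e x 0 0 + A k 1 * e x 1 0).
    exact: continuous_linear_form.
  by apply/funext => u; rewrite mulmx2.
move=> x; apply: cvgM; last exact: Ac.
apply: cvgV.
  rewrite sqrtr_eq0 -ltNge lt_neqAle addr_ge0 ?sqr_ge0// andbT eq_sym.
  apply: contra (Ae0 x); rewrite paddr_eq0 ?sqr_ge0// !sqrf_eq0.
  by move=> /andP[/eqP v0 /eqP v1]; exact/eqP/cV2_eq0.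
pose q y := (A *m e y) 0 0 * (A *m e y) 0 0 + (A *m e y) 1 0 * (A *m e y) 1 0.
have qc : continuous q by move=> y; apply: cvgD; apply: cvgM; exact: Ac.
exact: (@continuous_comp _ _ _ q (@Num.sqrt R) x (qc x)
  (@sqrt_continuous R (q x))).
Qed.

End ContinuousForms.

Section Circle.
Local Open Scope quotient_scope.
Variable R : realType.
Local Notation P1 := (P1 R).
Local Notation C := (set_type (@circle R)).

Lemma continuous_mx (X : topologicalType) m n (f : X -> 'M[R]_(m, n)) :
  (forall i j, continuous (fun x => f x i j)) -> continuous f.
Proof.
move=> fc x U [P Pf PU].
apply: (@filterS _ _ _ [set y | forall i j, P i j (f y i j)]).
  by move=> y; exact: PU.
by apply: filter_forall => i; apply: filter_forall => j; exact: fc.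
Qed.

Lemma continuous_entry m n i j : continuous (fun M : 'M[R]_(m, n) => M i j).
Proof.
move=> M U MU; exists (fun k l => [set y | k = i -> l = j -> U y]).
  move=> k l; have [ki|ki] := eqVneq k i; last first.
    by apply: filterE => y k'; rewrite k' eqxx in ki.
  have [lj|lj] := eqVneq l j; last first.
    by apply: filterE => y _ l'; rewrite l' eqxx in lj.
  by rewrite ki lj; apply: filterS MU => y Uy _ _; exact: Uy.
by move=> N /(_ i j); exact.
Qed.

Lemma continuous_circle_entry i : continuous (fun v : C => (val v) i 0).
Proof.
move=> v; apply: (@continuous_comp C _ _ val (fun M : 'cV[R]_2 => M i 0)).
  exact: initial_continuous.
exact: continuous_entry.
Qed.

Lemma repr_antipodal (u v : C) :
  \pi_P1 u == \pi_P1 v -> val u = val v \/ val u = - val v.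
Proof. by move=> /eqP /eqmodP /orP[] /eqP; [left|right]. Qed.

Lemma circle_neq0 (v : C) : val v != 0.
Proof.
apply/eqP => v0; have := set_mem (valP v); rewrite /circle /= v0 !mxE expr0n addr0.
by move/eqP; rewrite eq_sym oner_eq0.
Qed.

(** The arc is cut out by a weak inequality between functions that are even in the
    homogeneous coordinates, hence well defined and continuous on the line; a
    point [arc a a] is cut out by the square of a wedge. *)
Lemma closed_arc (a b : P1) : closed (arc a b).
Proof.
have [->|/eqP ab] := eqVneq a b.
  pose g (v : C) := wedge (hcoord b) (val v) ^+ 2.
  have gc : continuous (g \o repr : P1 -> R).
    apply: repr_comp_continuous.
      move=> v; rewrite /g.
      rewrite (_ : (fun u : C => _) = fun u =>
          wedge (hcoord b) (val u) * wedge (val u) (hcoord b) * -1).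
        exact: continuous_wedgeM continuous_circle_entry _ _ _ _.
      by apply/funext => u; rewrite (wedgeC (val u)); ring.
    move=> u v /repr_antipodal[]; rewrite /g => -> //.
    by apply/eqP; rewrite /wedge !mxE; ring.
  rewrite (_ : arc b b = (g \o repr) @^-1` [set x | x <= 0]).
    by apply: preimage_closed => //; exact: closed_le.
  apply/seteqP; split => x.
    move=> /arcxx -> /=; rewrite /g -/(hcoord b).
    by rewrite (_ : wedge _ _ = 0) ?expr0n//= /wedge; ring.
  move=> /= g0; apply: Or31; apply/esym/wedge_hcoord_eq0/eqP.
  by rewrite -sqrf_eq0 eq_le sqr_ge0 andbT.
pose w := wedge (hcoord b) (hcoord a).
pose g (v : C) := wedge (hcoord a) (val v) * wedge (val v) (hcoord b) * w.
have gc : continuous (g \o repr : P1 -> R).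
  apply: repr_comp_continuous.
    exact: continuous_wedgeM continuous_circle_entry _ _ _.
  move=> u v /repr_antipodal[]; rewrite /g => -> //.
  by apply/eqP; rewrite /wedge !mxE; ring.
rewrite (_ : arc a b = (g \o repr) @^-1` [set x | 0 <= x]).
  by apply: preimage_closed => //; exact: closed_ge.
have w0 : w != 0 by apply/eqP => /wedge_hcoord_eq0 /esym.
have waa u : wedge u u = 0 :> R by rewrite /wedge; ring.
apply/seteqP; split => x.
  rewrite /= /g -/(hcoord x); case=> [->|->|].
  - by rewrite waa !mul0r.
  - by rewrite waa mulr0 mul0r.
  - by rewrite /cyc => /ltW.
rewrite /= /g -/(hcoord x) => g0.
have [xa|xa] := eqVneq x a; first exact: Or31.
have [xb|xb] := eqVneq x b; first exact: Or32.
apply: Or33; rewrite /cyc lt_neqAle g0 andbT eq_sym !mulf_neq0//.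
  by apply: contra xa => /eqP /wedge_hcoord_eq0 ->.
by apply: contra xb => /eqP /wedge_hcoord_eq0 ->.
Qed.

(** The map lifts to the circle as v |-> A v / |A v|. *)
Lemma mobius_continuous (A : 'M[R]_2) : \det A = 1 -> continuous (mobius A).
Proof.
move=> A1; have Au := det1_unitmx A1.
have Av0 (v : C) : A *m val v != 0.
  apply: contra_neq (circle_neq0 v) => Av.
  by rewrite -[val v](mulKmx Au) Av mulmx0.
pose n (v : C) : C :=
  exist (fun u => u \in @circle R) _ (normalize_circle (Av0 v)).
pose g (v : C) : P1 := hpoint (A *m val v).
have gE : g = \pi_P1 \o n.
  apply/funext => v; rewrite /g /hpoint; congr (\pi_P1 _); apply: val_inj.
  by rewrite insubdK//; exact: normalize_circle.
change (continuous (g \o repr : P1 -> P1)).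
apply: repr_comp_continuous; last first.
  move=> u v /repr_antipodal[]; rewrite /g => -> //.
  by rewrite mulmxN -scaleN1r hpoint_scale// oppr_eq0 oner_eq0.
rewrite gE => v; apply: continuous_comp; last exact: pi_continuous.
apply: continuous_comp_initial.
apply: continuous_mx => i j; rewrite ord1.
rewrite (_ : (fun v => _) = fun v : C => (Num.sqrt ((A *m val v) 0 0 ^+ 2 +
    (A *m val v) 1 0 ^+ 2))^-1 * (A *m val v) i 0).
  exact: (continuous_normalize continuous_circle_entry).
by apply/funext => u; rewrite /= [LHS]mxE.
Qed.

End Circle.

Section Piecewise.
Variable R : realType.
Local Notation P1 := (P1 R).

(** The preimage of a closed set is a finite union of closed sets, one in each
    piece. *)
Lemma piecewise_continuous (h : P1 -> P1) : piecewise_PSL2 h -> continuous h.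
Proof.
move=> [s [_ hA hs]]; apply/continuous_closedP => B cB.
have -> : h @^-1` B =
    [set x | exists2 ab, ab \in s & (arc ab.1 ab.2 `&` h @^-1` B) x].
  apply/seteqP; split => x /= => [Bx|[ab _ []]//].
  by have [ab abs xab] := hs x; exists ab.
have {hs} : forall ab, ab \in s -> closed (arc ab.1 ab.2 `&` h @^-1` B).
  move=> ab /hA[A A1 hE].
  rewrite (_ : _ `&` _ = arc ab.1 ab.2 `&` mobius A @^-1` B).
    apply: closedI; first exact: closed_arc.
    by have /continuous_closedP := mobius_continuous A1; apply.
  by apply/seteqP; split => x [xab] /=; rewrite hE ?inE.
elim: s {hA} => [_|c s IH cl].
  rewrite (_ : [set x | _] = set0); first exact: closed0.
  by apply/seteqP; split => x // [].
rewrite (_ : [set x | _] = (arc c.1 c.2 `&` h @^-1` B) `|`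
    [set x | exists2 ab, ab \in s & (arc ab.1 ab.2 `&` h @^-1` B) x]).
  apply: closedU; first by apply: cl; rewrite mem_head.
  by apply: IH => ab abs; apply: cl; rewrite inE abs orbT.
apply/seteqP; split => x.
  move=> [ab]; rewrite inE => /orP[/eqP->|abs] xab; first by left.
  by right; exists ab.
move=> [xc|[ab abs xab]]; first by exists c; rewrite ?mem_head.
by exists ab => //; rewrite inE abs orbT.
Qed.

Lemma piecewise_monod (h h' : P1 -> P1) : cancel h h' -> cancel h' h ->
  h (P1_infty R) = P1_infty R -> piecewise_PSL2 h -> monod h.
Proof.
move=> hK h'K hi hp; split=> //; exists h'; split=> //.
  exact: piecewise_continuous.
exact/piecewise_continuous/(piecewise_inv hK h'K).
Qed.

(** Dividing a matrix by the square root of its determinant does not change the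
    projective map; so matrices with rational entries may be used. *)
Lemma PSL2_on_det (A : 'M[R]_2) (h : P1 -> P1) (I : set P1) :
  0 < \det A -> {in I, h =1 mobius A} -> PSL2_on h I.
Proof.
move=> dA hA; set r := Num.sqrt (\det A).
have r0 : r != 0 by rewrite sqrtr_eq0 -ltNge.
exists (r^-1 *: A).
  by rewrite detZ exprVn [r ^+ 2]sqr_sqrtr ?ltW// mulVf// gt_eqF.
move=> x /hA ->; rewrite /mobius -scalemxAl hpoint_scale//.
by rewrite invr_eq0.
Qed.

(** * The affine chart, and two elements of the group H *)

Definition affine_pt (x : R) : P1 := hpoint (\col_i (if i == 0 then x else 1)).

Definition affine_coord (y : P1) : R := hcoord y 0 0 / hcoord y 1 0.

Lemma affine_pt_neq0 (x : R) :
  (\col_i (if i == 0 then x else 1) : 'cV[R]_2) != 0.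
Proof.
by apply/eqP => /matrixP/(_ 1 0)/eqP; rewrite !mxE /= oner_eq0.
Qed.

Lemma infty_neq0 : (delta_mx 0 0 : 'cV[R]_2) != 0.
Proof. by apply/eqP => /matrixP/(_ 0 0)/eqP; rewrite !mxE /= oner_eq0. Qed.

Lemma affine_ptK : cancel affine_pt affine_coord.
Proof.
move=> x; rewrite /affine_coord /affine_pt.
have [k k0 ->] := hpointE (affine_pt_neq0 x).
by rewrite !mxE /= mulr1 mulrAC mulfV// mul1r.
Qed.

Lemma affine_pt_infty (x : R) : affine_pt x != P1_infty R.
Proof.
apply/eqP => e; have [k k0 kE] := hpointE (affine_pt_neq0 x).
have [l l0 lE] := hpointE infty_neq0.
move: kE; rewrite -/(affine_pt x) e lE => /matrixP/(_ 1 0)/eqP.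
by rewrite !mxE /= mulr1 mulr0 eq_sym (negPf k0).
Qed.

Lemma affine_coordK (y : P1) :
  y != P1_infty R -> affine_pt (affine_coord y) = y.
Proof.
move=> yi; have h1 : hcoord y 1 0 != 0.
  apply: contra yi => /eqP h1; apply/eqP; rewrite -(hcoordK y) /P1_infty.
  rewrite (_ : hcoord y = hcoord y 0 0 *: delta_mx 0 0).
    rewrite hpoint_scale//; apply: contra_neq (hcoord_neq0 y) => h0.
    exact: cV2_eq0.
  by apply: cV2_eqP; rewrite !mxE /= ?mulr1 ?mulr0.
rewrite -[RHS](hcoordK y) /affine_pt -(hpoint_scale _ h1); congr hpoint.
by apply: cV2_eqP; rewrite !mxE /= ?mulr1// /affine_coord mulrC divfK.
Qed.

Lemma cyc_hpoint (u v w : 'cV[R]_2) : u != 0 -> v != 0 -> w != 0 ->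
  cyc (hpoint u) (hpoint v) (hpoint w) = (0 < wedge u v * wedge v w * wedge w u).
Proof.
move=> u0 v0 w0; rewrite /cyc.
have [i i0 ->] := hpointE u0; have [j j0 ->] := hpointE v0.
have [k k0 ->] := hpointE w0; rewrite !wedgeZl !wedgeZr.
set r := wedge u v; set s := wedge v w; set t := wedge w u.
have -> : i * (j * r) * (j * (k * s)) * (k * (i * t)) =
  (i * j * k) ^+ 2 * (r * s * t) by ring.
by rewrite pmulr_rgt0// exprn_even_gt0//= !mulf_neq0.
Qed.

Lemma cyc_infty (x y : R) :
  cyc (P1_infty R) (affine_pt x) (affine_pt y) = (x < y).
Proof.
rewrite cyc_hpoint ?affine_pt_neq0 ?infty_neq0// /wedge !mxE /=.
by rewrite -[RHS]subr_gt0; congr (0 < _); ring.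
Qed.

Lemma cyc_affine_pt (x y z : R) :
  x < z -> cyc (affine_pt x) (affine_pt y) (affine_pt z) -> x <= y <= z.
Proof.
rewrite cyc_hpoint ?affine_pt_neq0// /wedge !mxE /= => xz.
rewrite (_ : _ * _ * _ = (z - x) * ((y - x) * (z - y))); last by ring.
rewrite pmulr_rgt0 ?subr_gt0// => h.
case: (ltP y x) => yx.
  have : 0 < (x - y) * (z - y) by apply: mulr_gt0; lra.
  by lra.
case: (ltP z y) => zy //.
have : 0 < (y - x) * (y - z) by apply: mulr_gt0; lra.
by lra.
Qed.

Lemma mobius_pt (A : 'M[R]_2) (x : R) : A 1 0 * x + A 1 1 != 0 ->
  mobius A (affine_pt x) = affine_pt ((A 0 0 * x + A 0 1) / (A 1 0 * x + A 1 1)).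
Proof.
move=> d0; rewrite /mobius; have [k k0 ->] := hpointE (affine_pt_neq0 x).
rewrite -scalemxAr hpoint_scale// /affine_pt -[RHS](hpoint_scale _ d0).
by congr hpoint; apply: cV2_eqP; rewrite mulmx2 !mxE /= ?mulr1// [RHS]mulrC divfK.
Qed.

Lemma mobius_infty (A : 'M[R]_2) : A 1 0 = 0 -> A 0 0 != 0 ->
  mobius A (P1_infty R) = P1_infty R.
Proof.
move=> A10 A00; rewrite /mobius; have [k k0 ->] := hpointE infty_neq0.
rewrite -scalemxAr hpoint_scale// /P1_infty -[RHS](hpoint_scale _ A00).
by congr hpoint; apply: cV2_eqP; rewrite mulmx2 !mxE /= ?A10; ring.
Qed.

Definition fix_infty (f : R -> R) (y : P1) : P1 :=
  if y == P1_infty R then P1_infty R else affine_pt (f (affine_coord y)).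

Lemma fix_infty_pt f x : fix_infty f (affine_pt x) = affine_pt (f x).
Proof. by rewrite /fix_infty (negPf (affine_pt_infty x)) affine_ptK. Qed.

Lemma fix_inftyK f f' : cancel f f' -> cancel (fix_infty f) (fix_infty f').
Proof.
move=> fK y; rewrite /fix_infty; have [//|yi] := eqVneq y (P1_infty R).
  by rewrite eqxx.
by rewrite (negPf (affine_pt_infty _)) affine_ptK fK affine_coordK.
Qed.

Definition mx22 (a b c d : R) : 'M[R]_2 :=
  \matrix_(i, j) (if i == 0 then if j == 0 then a else b
                  else if j == 0 then c else d).

(** Three pieces, of which the outer two are affine and so fix oo, suffice for
    both moves. *)
Lemma fix_infty_monod (f f' : R -> R) (u v p q a b c d r s : R) :
  cancel f f' -> cancel f' f -> u < v -> 0 < p -> 0 < r -> 0 < a * d - b * c ->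
  (forall x, x <= u -> f x = p * x + q) ->
  (forall x, u <= x <= v -> c * x + d != 0 /\ f x = (a * x + b) / (c * x + d)) ->
  (forall x, v <= x -> f x = r * x + s) ->
  monod (fix_infty f).
Proof.
move=> fK f'K uv p0 r0 dt fl fm fr.
apply: (piecewise_monod (fix_inftyK fK) (fix_inftyK f'K)).
  by rewrite /fix_infty eqxx.
have affine (p' q' : R) (I : set P1) : 0 < p' ->
    (forall x, I (affine_pt x) -> f x = p' * x + q') -> PSL2_on (fix_infty f) I.
  move=> p'0 h; apply: (@PSL2_on_det (mx22 p' q' 0 1)).
    by rewrite det22 !mxE /=; lra.
  move=> y /set_mem Iy; have [->|yi] := eqVneq y (P1_infty R).
    by rewrite mobius_infty ?mxE//= ?gt_eqF// /fix_infty eqxx.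
  rewrite -(affine_coordK yi) in Iy *; rewrite fix_infty_pt mobius_pt !mxE /=.
    by rewrite h// mul0r add0r divr1.
  by rewrite mul0r add0r oner_neq0.
exists [:: (P1_infty R, affine_pt u); (affine_pt u, affine_pt v);
  (affine_pt v, P1_infty R)]; split.
- by move=> ab _; rewrite !P_RT.
- move=> ab; rewrite !inE => /or3P[] /eqP -> /=.
  + apply: (affine p q) => // x [/eqP|/(can_inj affine_ptK) ->|].
    * by rewrite (negPf (affine_pt_infty x)).
    * exact: fl.
    * by rewrite cyc_infty => /ltW/fl.
  + apply: (@PSL2_on_det (mx22 a b c d)).
      by rewrite det22 !mxE.
    move=> y /set_mem uyv; have [yi|yi] := eqVneq y (P1_infty R).
      exfalso; move: uyv; rewrite yi => -[/esym/eqP|/esym/eqP|].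
      * by rewrite (negPf (affine_pt_infty u)).
      * by rewrite (negPf (affine_pt_infty v)).
      * by rewrite cyc_rot cyc_infty; lra.
    rewrite -(affine_coordK yi) in uyv *; set x := affine_coord y in uyv *.
    have xuv : u <= x <= v.
      case: uyv => [/(can_inj affine_ptK) ->|/(can_inj affine_ptK) ->|];
        rewrite ?lexx ?(ltW uv)//.
      exact: cyc_affine_pt.
    have [d0 fx] := fm x xuv.
    by rewrite fix_infty_pt mobius_pt !mxE //= fx.
  + apply: (affine r s) => // x [/(can_inj affine_ptK) ->|/eqP|].
    * exact: fr.
    * by rewrite (negPf (affine_pt_infty x)).
    * by rewrite -cyc_rot cyc_infty => /ltW/fr.
- have pieces := mem_seq3 (P1_infty R, affine_pt u) (affine_pt u, affine_pt v)
    (affine_pt v, P1_infty R).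
  move=> y; have [->|yi] := eqVneq y (P1_infty R).
    by exists (P1_infty R, affine_pt u); [exact: mem_head|exact: Or31].
  rewrite -(affine_coordK yi); set x := affine_coord y.
  case: (ltP x u) => xu.
    exists (P1_infty R, affine_pt u); first exact: mem_head.
    by apply: Or33; rewrite cyc_infty.
  case: (ltP v x) => vx.
    exists (affine_pt v, P1_infty R); first by have [_ _] := pieces.
    by apply: Or33; rewrite -cyc_rot cyc_infty.
  exists (affine_pt u, affine_pt v); first by have [_ + _] := pieces.
  have [->|xu'] := eqVneq x u; first exact: Or31.
  have [->|xv'] := eqVneq x v; first exact: Or32.
  apply: Or33; rewrite /= cyc_hpoint ?affine_pt_neq0// /wedge !mxE /=.
  rewrite (_ : _ * _ * _ = (x - u) * (v - x) * (v - u)); last by ring.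
  by rewrite !mulr_gt0 ?subr_gt0// lt_neqAle ?xu' ?xv' ?xu ?vx// eq_sym xu'.
Qed.

End Piecewise.

Section Inverses.
Variable F : realFieldType.
Implicit Types x : F.

Definition unshrink x := 4 / 3 * x.

Definition unbend x :=
  if x < 0 then x + 7^-1 else if x <= 1 then (7 * x + 1) / (7 + x) else x.

Lemma shrinkK : cancel (@shrink F) unshrink.
Proof. by move=> x; rewrite /shrink /unshrink; field. Qed.

Lemma unshrinkK : cancel unshrink (@shrink F).
Proof. by move=> x; rewrite /shrink /unshrink; field. Qed.

Lemma bendK : cancel (@bend F) unbend.
Proof.
move=> x; rewrite /bend /unbend.
case: (ltP x 7^-1) => x7.
  by rewrite (_ : _ < 0); [lra|lra].
case: (leP x 1) => x1; last first.
  have -> : (x < 0) = false by apply/negbTE; rewrite -leNgt; lra.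
  by rewrite leNgt x1.
have := @bend_itv F x; rewrite x7 x1 => /(_ isT)/andP[y0 y1].
rewrite ltNge y0 y1 /=; field; apply/andP; split; lra.
Qed.

Lemma unbendK : cancel unbend (@bend F).
Proof.
move=> x; rewrite /bend /unbend.
case: (ltP x 0) => x0.
  by rewrite (_ : _ < 7^-1); [lra|lra].
case: (leP x 1) => x1; last first.
  have -> : (x < 7^-1) = false by apply/negbTE; rewrite -leNgt; lra.
  by rewrite leNgt x1.
have y1 : (7 * x + 1) / (7 + x) <= 1 by rewrite ler_pdivrMr; lra.
have y7 : 7^-1 <= (7 * x + 1) / (7 + x) by rewrite ler_pdivlMr; lra.
rewrite ltNge y7 y1 /=; field; apply/andP; split; lra.
Qed.

End Inverses.

Section Monod.
Variable R : realType.

Lemma monod_shrink : monod (fix_infty (@shrink R)).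
Proof.
by apply: (@fix_infty_monod _ _ _ 0 1 (3 / 4) 0 (3 / 4) 0 0 1 (3 / 4) 0
  (@shrinkK R) (@unshrinkK R)); rewrite /shrink; try lra;
  move=> x xx; try lra; rewrite mul0r add0r oner_neq0 divr1 addr0.
Qed.

Lemma monod_bend : monod (fix_infty (@bend R)).
Proof.
apply: (@fix_infty_monod _ _ _ 7^-1 1 1 (- 7^-1) 7 (- 1) (- 1) 7 1 0
  (@bendK R) (@unbendK R)); try lra.
- move=> x; rewrite /bend le_eqVlt => /orP[/eqP->|->].
    by rewrite ltxx (_ : _ <= 1); [by field|lra].
  by lra.
- move=> x /andP[x7 x1]; split; first by rewrite gt_eqF//; lra.
  by rewrite /bend ltNge x7 x1 /= mulN1r [- x + 7]addrC.
- move=> x; rewrite /bend le_eqVlt => /orP[/eqP<-|x1].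
    have -> : (1 < 7^-1 :> R) = false by apply/negbTE; rewrite -leNgt; lra.
    by rewrite lexx; field.
  have -> : (x < 7^-1) = false by apply/negbTE; rewrite -leNgt; lra.
  by rewrite leNgt x1 /=; lra.
Qed.

Definition HR_shrink : HR R :=
  exist (fun f => f \in @monod R) _ (mem_set monod_shrink).

Definition HR_bend : HR R :=
  exist (fun f => f \in @monod R) _ (mem_set monod_bend).

End Monod.

(** * From a mean on the group to a mean on finite sets of rationals *)

Section Delta.
Variables (T : choiceType) (A : groupType) (x : T) (a : A).

Definition ds_delta : direct_sum T A := [fsfun y in [fset x]%fset => a | 1%g].

Lemma ds_deltaE : ds_delta x = a.
Proof. by rewrite /ds_fun fsfunE inE eqxx. Qed.

End Delta.

Section RationalSupport.
Variables (R : realType) (A : groupType).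
Local Notation P1 := (P1 R).
Local Notation dsum := (direct_sum P1 A).

Definition rat_pt (q : rat) : P1 := affine_pt (ratr q).

Lemma rat_pt_inj : injective rat_pt.
Proof. by move=> p q /(can_inj (@affine_ptK R))/fmorph_inj. Qed.

(** [xget] inverts [rat_pt] on its image; its value elsewhere is discarded by the
    condition on [f]. *)
Definition rat_supp (f : dsum) : {fset rat} :=
  [fset q in ((fun y => xget 0 [set q | rat_pt q = y]) @` finsupp f)%fset |
    f (rat_pt q) != 1%g]%fset.

Lemma mem_rat_supp f q : (q \in rat_supp f) = (f (rat_pt q) != 1%g).
Proof.
rewrite !inE /=; case: (boolP (f (rat_pt q) != 1%g)) => fq;
  rewrite ?andbF// andbT.
apply/imfsetP; exists (rat_pt q) => /=.
  by apply: contraR fq => /ds_out ->; rewrite eqxx.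
apply: rat_pt_inj; apply/esym.
exact: (@xgetPex _ 0 [set q' | rat_pt q' = rat_pt q] (ex_intro _ q erefl)).
Qed.

(** The inverse [g'] ensures that no other point is carried to a rational one. *)
Lemma rat_supp_act (h : HR R) (g g' : rat -> rat) (f : dsum) :
  cancel g g' -> cancel g' g -> (forall q, h (rat_pt q) = rat_pt (g q)) ->
  rat_supp (ds_act h f) = (g @` rat_supp f)%fset.
Proof.
move=> gK g'K hg; apply/fsetP => q; rewrite mem_rat_supp ds_actE.
rewrite -{1}(g'K q) -hg HR_Vk -mem_rat_supp.
apply/idP/imfsetP => [g'q|[p ps ->]]; first by exists (g' q).
by rewrite gK.
Qed.

End RationalSupport.

Lemma HR_shrink_rat (R : realType) q :
  HR_shrink R (rat_pt R q) = rat_pt R (shrink q).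
Proof. by rewrite /rat_pt ratr_shrink -fix_infty_pt. Qed.

Lemma HR_bend_rat (R : realType) q :
  HR_bend R (rat_pt R q) = rat_pt R (bend q).
Proof. by rewrite /rat_pt ratr_bend -fix_infty_pt. Qed.

Section MeanAlong.
Variables (R : realType) (G : topologicalGroupType) (mu : {scalar LUCB R G}).

(** The image of [mu] under [e].  The default 0 is taken on functions that are not
    left uniformly continuous after composition with [e]; under the hypothesis
    [eU] below, no bounded function is of this kind. *)
Definition mean_along (T : Type) (e : G -> T) (F : T -> R) : R :=
  mu (insubd 0 (F \o e : G -> R^o)).

Variables (T : Type) (e : G -> T) (U : set G).
Hypothesis U1 : nbhs 1%g U.
Hypothesis eU : forall x y : G, U (x^-1 * y)%g -> e x = e y.

Lemma lucb_along (F : T -> R) :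
  F \in bfun R T -> (F \o e : G -> R^o) \in lucb R G.
Proof.
move=> bF; apply/andP; split; first exact: bfun_comp.
apply/asboolP => eps eps0; exists U => // x y /eU exy /=.
by rewrite exy subrr normr0 ltW.
Qed.

Lemma val_along (F : T -> R) : F \in bfun R T ->
  val (insubd (0 : LUCB R G) (F \o e : G -> R^o)) = F \o e.
Proof. by move=> bF; rewrite insubdK//; exact: lucb_along. Qed.

Lemma mean_alongP : is_mean mu -> mean (mean_along e).
Proof.
move=> [mu0 mu1]; split.
- move=> k F H bF bH; rewrite /mean_along -linearP; congr (mu _).
  apply: val_inj; rewrite val_along; last exact: bfun_lin.
  by rewrite linearP /= !val_along.
- by move=> F bF F0; apply: mu0 => x; rewrite val_along//; exact: F0.
- by apply: mu1; rewrite val_along//; exact: bfun_cst.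
Qed.

Lemma mean_along_invariant (g : G) (s : T -> T) (F : T -> R) :
  left_invariant mu -> (forall x, e (g * x)%g = s (e x)) -> F \in bfun R T ->
  mean_along e (F \o s) = mean_along e F.
Proof.
move=> mui es bF; apply: (mui g); rewrite !val_along//; last exact: bfun_comp.
by apply/funext => x /=; rewrite es.
Qed.

End MeanAlong.

Theorem corollary8p5 (R : realType) (A : groupType)
    (ntA : exists a : A, a != 1%g) (amA : amenable R A) :
  ~ skew_amenable R (wreath_HR R A).
Proof.
move=> [mu [mum mui]].
pose G := wreath_HR R A; pose dsum := direct_sum (P1 R) A.
pose e (x : G) : dsum := x.1.
pose U : set G := [set u | u.1 = 1%g].
have U1 : nbhs (1%g : G) U by apply/wr_nbhsP; exists [::].
have eU (x y : G) : U (x^-1 * y)%g -> e x = e y.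
  move=> xy; rewrite -[y](mulVKg x).
  by case: (x^-1 * y)%g xy => f h fh; rewrite /e /= [f]fh ds_act_one mulg1.
have mm := mean_alongP U1 eU mum.
pose n := fun F : {fset rat} -> R => mean_along mu e (F \o @rat_supp R A).
have nm : mean n := mean_map _ mm.
have bs (F : {fset rat} -> R) :
  F \in bfun R _ -> F \o @rat_supp R A \in bfun R dsum by exact: bfun_comp.
have inv (h : HR R) (g g' : rat -> rat) : cancel g g' -> cancel g' g ->
    (forall q, h (rat_pt R q) = rat_pt R (g q)) -> image_invariant g n.
  move=> gK g'K hg F bF.
  rewrite /n -[RHS](mean_along_invariant U1 eU mui (g := (1%g, h))
    (s := ds_act h)).
  - congr (mean_along _ _ _); apply/funext => f /=.
    by rewrite (rat_supp_act _ gK g'K hg).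
  - by move=> [f k]; rewrite /e /= mul1g.
  - exact: bs.
(* Multiplying by a function supported at [q] makes the value at [q] nontrivial
   whenever it was trivial; so [q] is missed by [f] or by [d * f], not by both. *)
have half q : n (miss R q) <= 1 / 2.
  have [a a1] := ntA.
  pose d : dsum := ds_delta (rat_pt R q) a.
  have dq : d (rat_pt R q) = a := ds_deltaE _ _.
  pose tr (f : dsum) : dsum := (d * f)%g.
  have trE (x : G) : e (((d, 1%g) : wreath_HR R A) * x)%g = tr (e x).
    by rewrite /e /tr -[in RHS](ds_act1 x.1).
  have b0 := bs _ (bfun_miss R q); set F0 := (miss R q \o _) in b0.
  have b1 : F0 \o tr \in bfun R dsum by exact: bfun_comp.
  have F1 := mean_along_invariant U1 eU mui trE b0.
  have F01 (f : dsum) : F0 f + (F0 \o tr) f <= 1.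
    rewrite /F0 /tr /= /miss !mem_rat_supp !negbK ds_mulE [X in (X * _)%g]dq.
    case: eqP => [->|_]; last by rewrite add0r lern1 leq_b1.
    by rewrite mulg1 (negPf a1) addr0.
  have := mean_le mm (bfunD b0 b1) (bfun_cst _ (1 : R)) F01.
  rewrite (mean_cst mm) (meanD mm)// F1 -/(n (miss R q)); lra.
(* Four copies, as 3/4 - 2/2^k has to exceed 1/2. *)
have m2 := mean_unionP nm nm.
apply: (@no_mean R (mean_union (mean_union n n) (mean_union n n))).
- exact: mean_unionP.
- have ia := inv (HR_shrink R) _ _ (@shrinkK _) (@unshrinkK _) (@HR_shrink_rat R).
  by do !apply: mean_union_image_invariant.
- have ib := inv (HR_bend R) _ _ (@bendK _) (@unbendK _) (@HR_bend_rat R).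
  by do !apply: mean_union_image_invariant.
- move=> q; rewrite !mean_union_miss//.
  have b : 0 <= n (miss R q).
    by apply: (mean_ge0 nm) => [|s]; [exact: bfun_miss|rewrite ler0n].
  have := half q; move: (n _) b => x x0 x1.
  have y1 : x * x <= 1 / 4 by nra.
  have y0 : 0 <= x * x by exact: mulr_ge0.
  nra.
Qed.
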